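(* For any even integer $q\geq 4$ and any $a\in[-1,1]$, $$\dim_{\mathrm{H}}(\mu_{a,q})\ \geq\ 1-\frac{1-\log 2}{\log q}-\frac{1}{q\log q}\left(2\log 2+\frac{2}{q\cos\frac{\pi}{q}}\int_{\frac{\pi}{2}}^{\frac{q\pi}{4}}\log(\cos^2 z)\,\sin\frac{2z}{q}\,dz\right)+\frac{\log\cos\frac{\pi}{q}}{\log q}.$$
   Context: $\mathbb{T}=\mathbb{R}/\mathbb{Z}$. For a finite non-negative Borel measure $\mu$ on $\mathbb{T}$, the lower Hausdorff dimension is $$\dim_{\mathrm{H}}(\mu)=\inf\{\alpha:\ \text{there exists a Borel set } F \text{ with } \mu(F)\neq 0 \text{ and } \dim_{\mathrm{H}}F\leq\alpha\},$$ where $\dim_{\mathrm H}F$ is the Hausdorff dimension of the set $F$. For $a\in[-1,1]$ and an integer $q\geq3$, $\mu_{a,q}$ is the Riesz product $$\mu_{a,q}=\prod_{k=0}^{\infty}\bigl(1+a\cos(2\pi q^kx)\bigr),$$ i.e. the weak-$*$ limit, as $n\to\infty$, of the measures $\prod_{k=0}^{n}(1+a\cos(2\pi q^kx))\,dx$ on $\mathbb{T}$. *)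

(* Defs.v *)
From HB Require Import structures.
From mathcomp Require Import all_boot all_order all_algebra.
From mathcomp Require Import all_classical all_reals all_analysis.

Set Implicit Arguments.
Unset Strict Implicit.
Unset Printing Implicit Defensive.

Import Order.TTheory GRing.Theory Num.Theory.
Import numFieldNormedType.Exports.

Local Open Scope classical_set_scope.
Local Open Scope ring_scope.
Local Open Scope quotient_scope.

(* [Num.int] as an additive subgroup of R. *)
Definition int_subgroup (R : realType) : zmodClosed R :=
  GRing.ZmodClosed.clone R (@Num.int_num_subdef R) _.

Definition circle (R : realType) : Type := {ideal_quot (int_subgroup R)}.

HB.instance Definition _ (R : realType) :=
  generic_quotient.Quotient.on (circle R).
HB.instance Definition _ (R : realType) := GRing.Zmodule.on (circle R).
HB.instance Definition _ (R : realType) := isPointed.Build (circle R) 0.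

(* Distance to the nearest integer. *)
Definition dist_int (R : realType) (r : R) : R :=
  inf [set `|r - n%:~R| | n in [set: int]].

(* Quotient metric: as [repr] picks representatives, this is the infimum of
   |s - t| over all real lifts s of x and t of y. *)
Definition circle_dist (R : realType) (x y : circle R) : R :=
  dist_int (repr x - repr y).

Section CircleMetric.
Context {R : realType}.
Implicit Types (r s : R) (x y z : circle R) (n m : int).

Lemma dist_int_lbound r : lbound [set `|r - n%:~R| | n in [set: int]] 0.
Proof. by move=> _ [n _ <-]. Qed.

Lemma dist_int_has_inf r : has_inf [set `|r - n%:~R| | n in [set: int]].
Proof.
split; first by exists `|r - 0%:~R|, 0.
by exists 0; exact: dist_int_lbound.
Qed.

Lemma dist_int_le r n : dist_int r <= `|r - n%:~R|.
Proof. by apply: (ge_inf (dist_int_has_inf r).2); exists n. Qed.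

Lemma dist_int_ge r s : (forall n, s <= `|r - n%:~R|) -> s <= dist_int r.
Proof.
move=> h; apply: lb_le_inf; first exact: (dist_int_has_inf r).1.
by move=> _ [n _ <-].
Qed.

Lemma dist_int_ge0 r : 0 <= dist_int r.
Proof. by apply: dist_int_ge => n. Qed.

Lemma dist_intz n : dist_int n%:~R = 0 :> R.
Proof.
apply/eqP; rewrite eq_le dist_int_ge0 andbT.
by rewrite (le_trans (dist_int_le _ n))// subrr normr0.
Qed.

Lemma dist_intN r : dist_int (- r) = dist_int r.
Proof.
have h (t : R) : dist_int t <= dist_int (- t).
  apply: dist_int_ge => n; apply: (le_trans (dist_int_le _ (- n))).
  by rewrite rmorphN/= opprK -[leRHS]normrN opprB opprK addrC.
by apply/eqP; rewrite eq_le h andbT -{2}(opprK r) h.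
Qed.

Lemma dist_intD r s : dist_int (r + s) <= dist_int r + dist_int s.
Proof.
rewrite -lerBlDr; apply: dist_int_ge => n.
rewrite lerBlDl -lerBlDr; apply: dist_int_ge => m.
rewrite lerBlDl; apply: (le_trans (dist_int_le _ (n + m))).
by rewrite rmorphD/= opprD addrACA ler_normD.
Qed.

Lemma dist_int_eq0 r : dist_int r = 0 -> r \is a Num.int.
Proof.
move=> r0; have /andP[] := floor_itv r; set m := Num.floor r => mr rm.
have [->|rNm] := eqVneq r m%:~R; first exact: intr_int.
suff : 0 < dist_int r by rewrite r0 ltxx.
have r1 : 0 < r - m%:~R by rewrite subr_gt0 lt_neqAle eq_sym rNm.
have r2 : 0 < (m + 1)%:~R - r by rewrite subr_gt0.
apply: (@lt_le_trans _ _ (Num.min (r - m%:~R) ((m + 1)%:~R - r))).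
  by rewrite lt_min r1 r2.
apply: dist_int_ge => n; rewrite ge_min; have [nm|mn] := leP n m.
  apply/orP; left; apply: le_trans (ler_norm _).
  by rewrite lerD2l lerN2 ler_int.
apply/orP; right; rewrite distrC; apply: le_trans (ler_norm _).
by rewrite lerD2r ler_int -ltzD1 ltrD2r.
Qed.

Lemma dist_int_congr r s : r - s \is a Num.int -> dist_int r = dist_int s.
Proof.
move=> /intrP[n rs]; apply/eqP; rewrite eq_le; apply/andP; split.
  rewrite -(subrK s r) rs (le_trans (dist_intD _ _))//.
  by rewrite dist_intz add0r.
rewrite -(subrK r s) -opprB rs (le_trans (dist_intD _ _))//.
by rewrite dist_intN dist_intz add0r.
Qed.

Lemma circle_eqP r s :
  reflect (\pi_(circle R) r = \pi_(circle R) s) (r - s \is a Num.int).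
Proof.
by apply: (iffP idP) => [|/eqP]; [move=> h; apply/eqP|];
  rewrite -[_ == _]Quotient.idealrBE.
Qed.

Lemma circle_dist_pi r s :
  circle_dist (\pi_(circle R) r) (\pi_(circle R) s) = dist_int (r - s).
Proof.
apply: dist_int_congr; rewrite opprD addrACA rpredD//.
  by apply/circle_eqP; rewrite reprK.
by rewrite -opprD rpredN; apply/circle_eqP; rewrite reprK.
Qed.

Lemma circle_distxx x : circle_dist x x = 0.
Proof. by rewrite /circle_dist subrr (dist_intz 0). Qed.

Lemma circle_dist_positivity x y : circle_dist x y = 0 -> x = y.
Proof. by move=> /dist_int_eq0/circle_eqP; rewrite !reprK. Qed.

Lemma circle_dist_sym x y : circle_dist x y = circle_dist y x.
Proof. by rewrite /circle_dist -dist_intN opprB. Qed.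

Lemma circle_dist_triangle y x z :
  circle_dist x z <= circle_dist x y + circle_dist y z.
Proof.
by rewrite /circle_dist (le_trans _ (dist_intD _ _))// addrA subrK.
Qed.

End CircleMetric.

HB.instance Definition _ (R : realType) := isMetric.Build R (circle R)
  (@circle_distxx R) (@circle_dist_positivity R) (@circle_dist_sym R)
  (@circle_dist_triangle R).

HB.instance Definition _ (R : realType) :=
  @isMeasurable.Build (sigma_display (@open (circle R))) (circle R)
    <<s @open (circle R) >> (@sigma_algebra0 _ setT _)
    (@sigma_algebraC _ _) (@sigma_algebra_bigcup _ setT _).

Section Hausdorff.
Context {R : realType} {M : metricType R}.
Implicit Types (U F : set M) (s delta : R).
Local Open Scope ereal_scope.

(* The diameter of the empty set is -oo. *)
Definition diam U : \bar R := ereal_sup [set (mdist x y)%:E | x in U & y in U].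

(* diam(U)^s; the empty set counts for 0, also when s = 0, whereas
   nonempty sets count for 1 when s = 0. *)
Definition diam_pow s U : \bar R := if U == set0 then 0 else poweR (diam U) s.

Definition hausdorff_premeasure s delta F : \bar R :=
  ereal_inf [set \sum_(0 <= i <oo) diam_pow s (U i) | U in
    [set U : (set M)^nat | F `<=` \bigcup_i U i /\
                           forall i, diam (U i) <= delta%:E]].

Definition hausdorff_measure s F : \bar R :=
  ereal_sup [set hausdorff_premeasure s delta F |
             delta in [set delta | (0 < delta)%R]].

Definition hausdorff_dim F : \bar R :=
  ereal_inf [set s%:E | s in [set s | (0 <= s)%R /\ hausdorff_measure s F = 0]].

End Hausdorff.

Definition lower_hausdorff_dim (R : realType)
    (mu : {finite_measure set (circle R) -> \bar R}) : \bar R :=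
  ereal_inf [set alpha%:E | alpha in [set alpha : R |
    exists F : set (circle R),
      [/\ measurable F, mu F <> 0%E & (hausdorff_dim F <= alpha%:E)%E]]].

Definition riesz_density (R : realType) (a : R) (q n : nat) (x : R) : R :=
  \prod_(0 <= k < n.+1) (1 + a * cos (2 * pi * (q ^ k)%:R * x)).

(* mu is the weak-* limit of the measures [riesz_density a q n x dx] on the
   circle. Integrals with respect to dx on the circle are computed on the
   fundamental domain [0, 1]. *)
Definition is_riesz_product (R : realType) (a : R) (q : nat)
    (mu : {finite_measure set (circle R) -> \bar R}) : Prop :=
  forall f : circle R -> R, continuous f ->
    (\int[lebesgue_measure]_(x in `[0, 1])
        (f (\pi_(circle R) x) * riesz_density a q n x)) @[n --> \oo]
      --> \int[mu]_(x in [set: circle R]) f x.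

(* Main.v *)
(* Write T x = q x, r = 1 + a cos (2 pi x), and let L h (y) be the mean of r h
   over the q preimages of y under T. Since L 1 = 1, the measure mu gives mass at
   most C q^-n exp (S_n f (x)) to the ball of radius q^-n around x, where S_n f is
   the Birkhoff sum of a regularization f of ln r. Iterating the transfer operator
   bounds the exponential moments of S_n f, so outside sets of exponentially small
   measure S_n f <= n (B + e) as soon as L (ln r) <= B, and the mass distribution
   principle gives dim mu >= 1 - B / ln q.

   It remains to bound L (ln r). By convexity of x ln x and the symmetry a -> - a
   one may take a = 1. Let S (t) be the sum of phi = (1 + cos) ln (1 + cos) over
   the translates t + 2 pi j / q. As phi'' + phi = 1 + ln (1 + cos) - 2 cos, the
   product formula for 1 + cos shows that S'' + S is, up to a constant,
   ln (sin (q t / 2) ^ 2), which increases on [0, pi / q]; with the Neumann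
   conditions S' (0) = S' (pi / q) = 0 this makes S maximal at 0. Integrating
   S'' + S against sin (t + pi / q) between 0 and pi / 2 - pi / q expresses S (0)
   by the integral of the statement. The remaining term ln (cos (pi / q)) is
   nonpositive. *)
Require Import Defs.
From mathcomp Require Import all_boot all_order all_algebra.
From mathcomp Require Import all_classical all_reals all_analysis.
From mathcomp Require Import measurable_realfun.
From mathcomp Require Import ring lra zify.
From mathcomp.real_closed Require complex.

Import Order.TTheory GRing.Theory Num.Theory.
Import numFieldNormedType.Exports.

Local Open Scope classical_set_scope.
Local Open Scope ring_scope.

Set Implicit Arguments.
Unset Strict Implicit.
Unset Printing Implicit Defensive.

(** * Sums over rotations by multiples of 2 pi / q *)

Definition rot_sum {R : realType} (q : nat) (u : R -> R) (t : R) : R :=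
  \sum_(j < q) u (t + 2 * pi * j%:R / q%:R).

(** Derivatives are asked only inside the interval, because for the sums over rotations they may
    have a logarithmic singularity at an endpoint. *)
Lemma nondecr_of_derive (R : realType) (f df : R -> R) (a b : R) : a <= b ->
  (forall x, a < x < b -> is_derive x 1 f (df x)) -> continuous f ->
  (forall x, a < x < b -> 0 <= df x) -> f a <= f b.
Proof.
rewrite le_eqVlt => /predU1P[-> //|ab] fdf cf df0.
have fd x : x \in `]a, b[ -> is_derive x 1 f (df x).
  by rewrite in_itv/=; exact: fdf.
have [c] := MVT ab fd (continuous_subspaceT cf).
by rewrite in_itv/= => /df0 c0 h; rewrite -subr_ge0 h mulr_ge0// subr_ge0 ltW.
Qed.

Section RotSum.
Context {R : realType}.
Implicit Types (u v : R -> R) (t : R) (q k : nat).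

Lemma rot_sum_periodic q u t : (0 < q)%N -> (forall s, u (s + 2 * pi) = u s) ->
  rot_sum q u (t + 2 * pi / q%:R) = rot_sum q u t.
Proof.
case: q => // q _ up; rewrite /rot_sum big_ord_recr big_ord_recl/= addrC.
have q0 : q.+1%:R != 0 :> R by rewrite pnatr_eq0.
congr (_ + _).
  rewrite mulr0 mul0r addr0 -[RHS]up; congr u.
  by rewrite -[q.+1%:R]natr1 in q0 *; field.
by apply: eq_bigr => i _; congr u; rewrite /bump/= add1n -natr1; ring.
Qed.

Lemma rot_sum_periodic_nat q u t k : (0 < q)%N ->
  (forall s, u (s + 2 * pi) = u s) ->
  rot_sum q u (t + 2 * pi / q%:R * k%:R) = rot_sum q u t.
Proof.
move=> q0 up; elim: k t => [|k IH] t; first by rewrite mulr0 addr0.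
by rewrite -[RHS]IH -[RHS](rot_sum_periodic _ q0 up) -natr1; congr (rot_sum _ _ _);
  ring.
Qed.

(** For even [q] the angle [pi] amounts to [q./2] steps of length [2 * pi / q]. *)
Lemma rot_sum_pi q u t : (0 < q)%N -> ~~ odd q ->
  (forall s, u (s + 2 * pi) = u s) ->
  rot_sum q u (t + pi) = rot_sum q u t.
Proof.
move=> q0 qe up; rewrite -(rot_sum_periodic_nat t q./2 q0 up).
congr (rot_sum _ _ _); congr (_ + _).
have h : q%:R = 2 * q./2%:R :> R.
  by rewrite -natrM mul2n; congr (_%:R); rewrite -[LHS]odd_double_half (negbTE qe).
have : q%:R != 0 :> R by rewrite pnatr_eq0 -lt0n.
by rewrite h => hh; field; move: hh; rewrite mulf_eq0 negb_or => /andP[].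
Qed.

(** The index reversal [j -> q - 1 - j] turns the negated angles into the original ones up to one
    step and one full turn, both absorbed by periodicity. *)
Lemma rot_sumN q u t : (0 < q)%N -> (forall s, u (s + 2 * pi) = u s) ->
  rot_sum q u (- t) = rot_sum q (fun s => u (- s)) t.
Proof.
move=> q0 up; rewrite -(rot_sum_periodic _ q0 up) /rot_sum.
rewrite (reindex_inj rev_ord_inj)/=; apply: eq_bigr => i _.
rewrite -[RHS]up; congr u; rewrite natrB// -natr1.
have : q%:R != 0 :> R by rewrite pnatr_eq0 -lt0n.
by move=> ?; field.
Qed.

(** The shift by [pi] both preserves the sum and changes its sign. *)
Lemma rot_sum_eq0 q u t : (0 < q)%N -> ~~ odd q ->
  (forall s, u (s + pi) = - u s) -> rot_sum q u t = 0.
Proof.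
move=> q0 qe ua.
have up s : u (s + 2 * pi) = u s.
  by rewrite (_ : 2 * pi = pi + pi); [rewrite addrA !ua opprK | ring].
have := rot_sum_pi t q0 qe up.
rewrite /rot_sum; under eq_bigr do rewrite addrAC ua.
by rewrite sumrN => h; lra.
Qed.

Lemma continuous_rot_sum q u : continuous u -> continuous (rot_sum q u).
Proof.
move=> cu; apply: continuous_big; first exact: add_continuous.
move=> i _ t; apply: continuous_comp; last exact: cu.
by apply: cvgD; [exact: cvg_id|exact: cvg_cst].
Qed.

Lemma is_derive_rot_sum q u (du : R -> R) t :
  (forall j : 'I_q, is_derive (t + 2 * pi * j%:R / q%:R) 1 u
     (du (t + 2 * pi * j%:R / q%:R))) ->
  is_derive t 1 (rot_sum q u) (rot_sum q du t).
Proof.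
move=> h; rewrite /rot_sum.
rewrite (_ : (fun t0 => _) = \sum_(j < q) (u \o (+%R^~ (2 * pi * j%:R / q%:R))));
  last first.
  by apply/funext => x; rewrite fct_sumE.
apply: is_derive_sum => i.
have := @is_derive1_comp R u (+%R^~ (2 * pi * i%:R / q%:R)) t _ 1 (h i).
by rewrite mulr1; apply; rewrite -[X in is_derive _ _ _ X]addr0; apply: is_deriveD.
Qed.

End RotSum.

(** * A product formula for [1 + cos] over rotations *)

Section ProductFormula.
Import complex.
Context {R : realType}.
Implicit Types (t s : R) (n q : nat).

Let cis t : R[i] := (cos t +i* sin t)%C.
Let N (z : R[i]) : R := complex.Re z ^+ 2 + complex.Im z ^+ 2.

Let NM (z w : R[i]) : N (z * w) = N z * N w.
Proof. by case: z => a b; case: w => c d; rewrite /N/=; ring. Qed.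

Let cisD t s : cis (t + s) = cis t * cis s.
Proof. by rewrite /cis cosD sinD/=; apply/eqP; rewrite eq_complex/=; apply/andP;
  split; apply/eqP; ring. Qed.

Let cisX t n : cis t ^+ n = cis (t * n%:R).
Proof.
elim: n => [|n IH]; first by rewrite mulr0 /cis cos0 sin0.
by rewrite exprS IH -cisD -natr1; congr cis; ring.
Qed.

Let cis2pi n : cis (2 * pi * n%:R) = 1.
Proof.
by rewrite -cisX (_ : cis _ = 1) ?expr1n// /cis mulr_natl cos2pi sin2pi.
Qed.

Let cis_neq1 t : 0 < t < 2 * pi -> cis t != 1.
Proof.
move=> /andP[t0 t2]; apply/eqP => /(congr1 (@complex.Re R))/= c1.
have : 0 < sin (t / 2) by apply: sin_gt0_pi; apply/andP; split; lra.
have := cos_mulr2n (t / 2); rewrite (_ : t / 2 *+ 2 = t); last by field.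
by rewrite c1 cos2sin2; nra.
Qed.

(** As [1 + cos (t + y)] is half the squared modulus of [cis (- t) + cis y], the product is read off
    from the factorization of [X^q - 1] over the powers of [w], evaluated at [X = - cis (- t)].
    Evenness of [q] removes the sign of [X^q]. *)
Lemma prod_1Dcos q t : (0 < q)%N -> ~~ odd q ->
  \prod_(j < q) (1 + cos (t + 2 * pi * j%:R / q%:R)) =
  2 ^- q * (4 * sin (q%:R * t / 2) ^+ 2).
Proof.
move=> q0 qe.
have qR0 : q%:R != 0 :> R by rewrite pnatr_eq0 -lt0n.
have qp : 0 < q%:R :> R by rewrite ltr0n.
pose w := cis (2 * pi / q%:R).
have wq : q.-primitive_root w.
  apply/andP; split => //; apply/forallP => i; rewrite unity_rootE cisX.
  have [iq|iq] := eqVneq i.+1 q.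
    by rewrite iq (_ : _ * q%:R = 2 * pi * 1%:R) ?cis2pi ?eqxx//; field.
  apply/eqP/negbTE/cis_neq1.
  rewrite mulr_gt0 ?ltr0n ?divr_gt0 ?mulr_gt0 ?pi_gt0//=.
  rewrite mulrAC ltr_pdivrMr// ltr_pM2l ?mulr_gt0 ?pi_gt0// ltr_nat.
  by rewrite ltn_neqAle iq ltn_ord.
have := congr1 (fun p => N p.[- cis (- t)]) (factor_Xn_sub_1 wq).
set rhs := (RHS in _ -> RHS); rewrite /= horner_prod !hornerE.
rewrite exprNn -signr_odd (negbTE qe) expr0 mul1r cisX.
have -> : N (cis (- t * q%:R) - 1) = 4 * sin (q%:R * t / 2) ^+ 2.
  rewrite /N /=.
  have -> : - t * q%:R = - (q%:R * t / 2 *+ 2) by field.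
  rewrite cosN sinN cos_mulr2n sin_mulr2n.
  by have := cos2sin2 (q%:R * t / 2) => h; ring: h.
rewrite /rhs => <- {rhs}.
rewrite big_mkord (big_morph N (id1 := 1) NM); last by rewrite /N/=; ring.
have -> : 2 ^- q = \prod_(j < q) 2^-1 :> R by rewrite prodr_const card_ord exprVn.
rewrite -big_split/=.
apply: eq_bigr => i _.
rewrite !hornerE cisX /N /= cosN sinN.
rewrite cosD (_ : 2 * pi / q%:R * i%:R = 2 * pi * i%:R / q%:R); last by field.
set y := 2 * pi * _ / _.
have h1 := cos2Dsin2 t; have h2 := cos2Dsin2 y.
have -> : (- cos t - cos y) ^+ 2 + (- - sin t - sin y) ^+ 2 =
  (cos t ^+ 2 + sin t ^+ 2) + (cos y ^+ 2 + sin y ^+ 2) +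
  2 * (cos t * cos y - sin t * sin y) by ring.
by rewrite h1 h2; field.
Qed.

End ProductFormula.
(** * The function (1 + cos) ln (1 + cos) *)

Section LogCos.
Context {R : realType}.
Implicit Types (t x : R).

Definition philog t : R := (1 + cos t) * ln (1 + cos t).
(** Minus the derivative of [philog], without its [sin] term, which cancels in sums over
    rotations. *)
Definition slog t : R := sin t * ln (1 + cos t).

(** Near 0, the inequality [ln y < y] at [y = 1 / sqrt |x|] bounds the function by
    [2 * sqrt |x|]. *)
Lemma continuous_mul_ln_norm : continuous (fun x : R => x * ln `|x|).
Proof.
move=> x; have [->|x0] := eqVneq x 0; last first.
  apply: cvgM; first exact: cvg_id.
  apply: (continuous_comp (f := fun x : R => `|x|) (g := @ln R)).
    exact: norm_continuous.
  by apply: continuous_ln; rewrite normr_gt0.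
rewrite /continuous_at mul0r.
have sq0 : 2 * Num.sqrt `|y| @[y --> (0 : R)] --> (0 : R).
  rewrite -[X in _ --> X](mulr0 2); apply: cvgM; first exact: cvg_cst.
  have h : Num.sqrt `|y| @[y --> (0 : R)] --> Num.sqrt `|0 : R|.
    by apply: (continuous_comp (@norm_continuous _ _ _)); exact: sqrt_continuous.
  by rewrite normr0 sqrtr0 in h.
apply/cvgr0Pnorm_le => e e0.
move/cvgr0Pnorm_le : sq0 => /(_ e e0) sq0.
have y1 : \forall y \near (0 : R), `|y| <= 1 by exact: nbhs0_le.
near=> y; have [->|yn0] := eqVneq y 0; first by rewrite mul0r normr0 ltW.
apply: le_trans (_ : `|2 * Num.sqrt `|y| | <= e); last by near: y.
have y_le1 : `|y| <= 1 by near: y.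
have yp : 0 < `|y| by rewrite normr_gt0.
rewrite normrM [X in _ <= X]ger0_norm ?mulr_ge0 ?sqrtr_ge0//.
rewrite (ler0_norm (ln_le0 y_le1)).
move: `|y| yp => w w0; have sp : 0 < Num.sqrt w by rewrite sqrtr_gt0.
rewrite -{1 2}(sqr_sqrtr (ltW w0)) lnXn//.
move: (Num.sqrt w) sp => s s0.
have := ln_sublinear (x := s^-1); rewrite invr_gt0 s0 lnV ?posrE// => /(_ isT) h.
have -> : 2 * s = s ^+ 2 * (2 * s^-1) by field; exact: lt0r_neq0.
by rewrite ler_pM2l ?exprn_gt0// mulr2n; lra.
Unshelve. all: by end_near. Qed.

Lemma onePcos t : 1 + cos t = 2 * cos (t / 2) ^+ 2.
Proof.
have {1}-> : t = t / 2 *+ 2 by field.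
by rewrite cos_mulr2n; ring.
Qed.

Lemma onePcos_ge0 t : 0 <= 1 + cos t.
Proof. by have := cos_geN1 t; lra. Qed.

Let ln1Dcos t : cos (t / 2) * ln (1 + cos t) =
  cos (t / 2) * ln 2 + 2 * (cos (t / 2) * ln `|cos (t / 2)|).
Proof.
have [->|c0] := eqVneq (cos (t / 2)) 0; first by rewrite !mul0r mulr0 addr0.
have cp : 0 < `|cos (t / 2)| by rewrite normr_gt0.
rewrite onePcos -real_normK ?num_real// lnM ?posrE ?exprn_gt0// lnXn//.
by rewrite mulr2n; ring.
Qed.

Let half_cos_continuous : continuous (fun t : R => cos (t / 2)).
Proof.
move=> t; apply: (continuous_comp (f := fun t : R => t / 2) (g := @cos R)).
  by apply: cvgM; [exact: cvg_id|exact: cvg_cst].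
exact: continuous_cos.
Qed.

(** The common singular factor of [philog] and [slog], by the half-angle formulas. The factor
    [cos (t / 2)] tames the logarithm at odd multiples of [pi]. *)
Let cln_continuous : continuous (fun t : R => cos (t / 2) * ln (1 + cos t)).
Proof.
under [X in continuous X]funext do rewrite ln1Dcos.
move=> t; apply: cvgD; first by apply: cvgM;
  [exact: half_cos_continuous|exact: cvg_cst].
apply: cvgM; first exact: cvg_cst.
apply: (continuous_comp (f := fun t : R => cos (t / 2)) (g := fun x : R => x * ln
  `|x|)).
  exact: half_cos_continuous.
exact: continuous_mul_ln_norm.
Qed.

Lemma continuous_philog : continuous philog.
Proof.
rewrite (_ : philog = fun t => 2 * cos (t / 2) * (cos (t / 2) * ln (1 + cos t))).
  move=> t; apply: cvgM; last exact: cln_continuous.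
  by apply: cvgM; [exact: cvg_cst|exact: half_cos_continuous].
by apply/funext => t; rewrite /philog {1}onePcos; ring.
Qed.

Lemma continuous_slog : continuous slog.
Proof.
rewrite (_ : slog = fun t => 2 * sin (t / 2) * (cos (t / 2) * ln (1 + cos t))).
  move=> t; apply: cvgM; last exact: cln_continuous.
  apply: cvgM; first exact: cvg_cst.
  apply: (continuous_comp (f := fun t : R => t / 2) (g := @sin R)).
    by apply: cvgM; [exact: cvg_id|exact: cvg_cst].
  exact: continuous_sin.
apply/funext => t; rewrite /slog.
have {1}-> : t = t / 2 *+ 2 by field.
by rewrite sin_mulr2n; ring.
Qed.

Lemma is_derive_ln1Dcos t : 0 < 1 + cos t ->
  is_derive t 1 (fun x : R => ln (1 + cos x)) (- sin t / (1 + cos t)).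
Proof.
move=> c0; rewrite mulrC.
apply: (@is_derive1_comp R (@ln R) (fun x => 1 + cos x)).
  exact: is_derive1_ln.
by rewrite -[X in is_derive _ _ _ X]add0r; apply: is_deriveD.
Qed.

Lemma is_derive_philog t : 0 < 1 + cos t ->
  is_derive t 1 philog (- slog t - sin t).
Proof.
move=> c0; have c1 : 1 + cos t != 0 by rewrite lt0r_neq0.
have d1 : is_derive t 1 (fun x : R => 1 + cos x) (0 - sin t) by apply: is_deriveD.
have := is_deriveM d1 (is_derive_ln1Dcos c0).
rewrite (_ : _ + _ = - slog t - sin t)//.
rewrite /slog /GRing.scale/=; by field.
Qed.

Lemma is_derive_slog t : 0 < 1 + cos t ->
  is_derive t 1 slog (philog t - ln (1 + cos t) + cos t - 1).
Proof.
move=> c0; have c1 : 1 + cos t != 0 by rewrite lt0r_neq0.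
have := is_deriveM (is_derive_sin t) (is_derive_ln1Dcos c0).
set d := (X in is_derive _ _ _ X -> _).
suff -> : d = philog t - ln (1 + cos t) + cos t - 1 by [].
rewrite /d /philog /GRing.scale/=.
have h : sin t * (- sin t / (1 + cos t)) = cos t - 1.
  by apply: (mulIf c1); have := sin2cos2 t => h; field: h.
by rewrite h; ring.
Qed.

End LogCos.
(** * The maximum of the rotated sums *)

Lemma ln_prod (R : realType) (I : Type) (r : seq I) (F : I -> R) :
  (forall i, 0 < F i) -> ln (\prod_(i <- r) F i) = \sum_(i <- r) ln (F i).
Proof.
move=> F0; elim: r => [|i r IH]; first by rewrite !big_nil ln1.
by rewrite !big_cons lnM ?posrE ?prodr_gt0// IH.
Qed.

(* For a fixed [x] put [k = l x]; as [l - k] changes sign from - to + at [x],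
   [- T cos t + (S - k) sin t] decreases on [0, x] and
   [- T cos (L - t) - (S - k) sin (L - t)] increases on [x, L]. *)
Lemma oscillator_comparison (R : realType) (S T l : R -> R) (L x : R) :
  L <= pi / 2 -> continuous S -> continuous T -> T 0 = 0 -> T L = 0 ->
  (forall t : R, 0 < t < L -> is_derive t 1 S (- T t)) ->
  (forall t : R, 0 < t < L -> is_derive t 1 T (S t - l t)) ->
  (forall s t : R, 0 < s -> s <= t -> t < L -> l s <= l t) ->
  0 < x < L -> 0 <= T x.
Proof.
move=> L2 cS cT T0 TL dS dT ml /andP[x0 xL].
have pi0 := pi_gt0 R.
pose f t := T t * cos t - (S t - l x) * sin t.
pose g t := - (T t * cos (L - t)) - (S t - l x) * sin (L - t).
have dcL (t : R) : is_derive t 1 (fun t : R => cos (L - t)) (sin (L - t)).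
  have := @is_derive1_comp R (@cos R) (fun t : R => L - t) t (- sin (L - t)) (- 1).
  rewrite mulrN1 opprK; apply.
  by rewrite -[X in is_derive _ _ _ X]add0r; apply: is_deriveB.
have dsL (t : R) : is_derive t 1 (fun t : R => sin (L - t)) (- cos (L - t)).
  have := @is_derive1_comp R (@sin R) (fun t : R => L - t) t (cos (L - t)) (- 1).
  rewrite mulrN1; apply.
  by rewrite -[X in is_derive _ _ _ X]add0r; apply: is_deriveB.
have ccL : continuous (fun t : R => cos (L - t)).
  by move=> t; apply: differentiable_continuous; apply/derivable1_diffP; case: (dcL t).
have csL : continuous (fun t : R => sin (L - t)).
  by move=> t; apply: differentiable_continuous; apply/derivable1_diffP; case: (dsL t).
have fx : f 0 <= f x.
  apply: (@nondecr_of_derive _ _ (fun t => (l x - l t) * cos t)).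
  - exact: ltW.
  - move=> t /andP[t0 tx].
    have tL : 0 < t < L by rewrite t0 (lt_trans tx).
    have := is_deriveB (is_deriveM (dT _ tL) (is_derive_cos t))
      (is_deriveM (is_deriveB (dS _ tL) (is_derive_cst (l x) t 1)) (is_derive_sin t)).
    set d := (X in is_derive _ _ _ X -> _).
    suff -> : d = (l x - l t) * cos t by [].
    have e : (S - cst (l x)) t = S t - l x by [].
    by rewrite /d e /GRing.scale/=; ring.
  - move=> t; apply: cvgB; apply: cvgM;
    [exact: cT|exact: continuous_cos| |exact: continuous_sin].
    by apply: cvgB; [exact: cS|exact: cvg_cst].
  - move=> t /andP[t0 tx]; apply: mulr_ge0; first by rewrite subr_ge0 ml// ltW.
    by apply: cos_ge0_pihalf; apply/andP; split; lra.
have gx : g x <= g L.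
  apply: (@nondecr_of_derive _ _ (fun t => (l t - l x) * cos (L - t))).
  - exact: ltW.
  - move=> t /andP[tx tl].
    have tL : 0 < t < L by rewrite tl (lt_trans x0).
    have := is_deriveB (is_deriveN (is_deriveM (dT _ tL) (dcL t)))
      (is_deriveM (is_deriveB (dS _ tL) (is_derive_cst (l x) t 1)) (dsL t)).
    set d := (X in is_derive _ _ _ X -> _).
    suff -> : d = (l t - l x) * cos (L - t) by [].
    have e : (S - cst (l x)) t = S t - l x by [].
    by rewrite /d e /GRing.scale/=; ring.
  - move=> t; apply: cvgB.
      by apply: cvgN; apply: cvgM; [exact: cT|exact: ccL].
    apply: cvgM; last exact: csL.
    by apply: cvgB; [exact: cS|exact: cvg_cst].
  - move=> t /andP[tx tl]; apply: mulr_ge0; first by rewrite subr_ge0 ml// ltW.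
    by apply: cos_ge0_pihalf; apply/andP; split; lra.
rewrite /f T0 mul0r sin0 mulr0 subrr in fx.
rewrite /g TL mul0r oppr0 subrr sin0 mulr0 subrr in gx.
have sx : 0 < sin x by apply: sin_gt0_pi; apply/andP; split; lra.
have sL : 0 < sin (L - x) by apply: sin_gt0_pi; apply/andP; split; lra.
(* The combination [f x * sin (L - x) - g x * sin x] eliminates [S x - l x] and leaves
   [T x * sin L]. *)
have sLL : 0 < sin L by apply: sin_gt0_pi; apply/andP; split; lra.
rewrite -(pmulr_lge0 _ sLL).
rewrite (_ : sin L = cos x * sin (L - x) + cos (L - x) * sin x); last first.
  by have := sinD (L - x) x; rewrite subrK => ->; ring.
have h1 := mulr_ge0 fx (ltW sL); have h2 := mulr_le0_ge0 gx (ltW sx).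
move: (sin (L - x)) (cos (L - x)) (sin x) (cos x) (T x) (S x - l x) h1 h2.
by move=> a b c d e k h1 h2; lra.
Qed.

Section RotatedEntropy.
Context {R : realType} (q : nat) (q_even : ~~ odd q) (q_ge4 : (4 <= q)%N).

Let q0 : (0 < q)%N. Proof. by case: q q_ge4. Qed.
Let qp : 0 < q%:R :> R. Proof. by rewrite ltr0n. Qed.
Let qn0 : q%:R != 0 :> R. Proof. by rewrite lt0r_neq0. Qed.
Let p0 : 0 < pi :> R. Proof. exact: pi_gt0. Qed.

(** Closed form, where the sine is nonzero, of the rotated sum of [1 + ln (1 + cos)]. It is the term
    [l] in the system [S' = - T], [T' = S - l] satisfied by the rotated sums [S] of [philog] and [T]
    of [slog]. *)
Definition log_rot_sum (t : R) : R :=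
  q%:R + (2 - q%:R) * ln 2 + ln (sin (q%:R * t / 2) ^+ 2).

Let cos2pi (s : R) : cos (s + 2 * pi) = cos s.
Proof. by rewrite mulr_natl cosD2pi. Qed.

Let sin2pi (s : R) : sin (s + 2 * pi) = sin s.
Proof. by rewrite mulr_natl sinD2pi. Qed.

Let phi2pi (s : R) : philog (s + 2 * pi) = philog s.
Proof. by rewrite /philog cos2pi. Qed.

Let slog2pi (s : R) : slog (s + 2 * pi) = slog s.
Proof. by rewrite /slog cos2pi sin2pi. Qed.

Lemma rot_sum_cos (t : R) : rot_sum q cos t = 0.
Proof. by apply: rot_sum_eq0 => // s; rewrite cosDpi. Qed.

Lemma rot_sum_sin (t : R) : rot_sum q sin t = 0.
Proof. by apply: rot_sum_eq0 => // s; rewrite sinDpi. Qed.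

Lemma onePcos_gt0 (t : R) : sin (q%:R * t / 2) != 0 ->
  forall j : 'I_q, 0 < 1 + cos (t + 2 * pi * j%:R / q%:R).
Proof.
move=> s0 j; rewrite lt0r onePcos_ge0 andbT.
have : \prod_(j < q) (1 + cos (t + 2 * pi * j%:R / q%:R)) != 0.
  by rewrite prod_1Dcos// !mulf_neq0// ?invr_neq0 ?expf_neq0.
by move/prodf_neq0 => /(_ j); apply.
Qed.

Lemma rot_sum_ln (t : R) : sin (q%:R * t / 2) != 0 ->
  rot_sum q (fun s => ln (1 + cos s)) t =
  (2 - q%:R) * ln 2 + ln (sin (q%:R * t / 2) ^+ 2).
Proof.
move=> s0; rewrite /rot_sum -ln_prod; last exact: onePcos_gt0.
rewrite prod_1Dcos//.
have sp : 0 < sin (q%:R * t / 2) ^+ 2 by rewrite exprn_even_gt0.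
move: (sin _ ^+ 2) sp => Y sp.
rewrite lnM ?posrE ?invr_gt0 ?exprn_gt0 ?mulr_gt0//.
rewrite lnM ?posrE// lnV ?posrE ?exprn_gt0// lnXn//.
rewrite (_ : 4 = 2 ^+ 2); last by ring.
by rewrite lnXn// -[ln 2 *+ q]mulr_natl -[ln 2 *+ 2]mulr_natl; ring.
Qed.

Lemma is_derive_rot_philog (t : R) : sin (q%:R * t / 2) != 0 ->
  is_derive t 1 (rot_sum q philog) (- rot_sum q slog t).
Proof.
move=> s0.
rewrite (_ : - _ = rot_sum q (fun s => - slog s - sin s) t).
  by apply: is_derive_rot_sum => j; apply: is_derive_philog; exact: onePcos_gt0.
rewrite {2}/rot_sum big_split/= sumrN sumrN.
by have := rot_sum_sin t; rewrite /rot_sum => ->; rewrite subr0.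
Qed.

Lemma is_derive_rot_slog (t : R) : sin (q%:R * t / 2) != 0 ->
  is_derive t 1 (rot_sum q slog) (rot_sum q philog t - log_rot_sum t).
Proof.
move=> s0.
rewrite (_ : _ - _ =
    rot_sum q (fun s => philog s - ln (1 + cos s) + cos s - 1) t).
  by apply: is_derive_rot_sum => j; apply: is_derive_slog; exact: onePcos_gt0.
rewrite /log_rot_sum -addrA -rot_sum_ln// {3}/rot_sum !big_split/= !sumrN.
have := rot_sum_cos t; rewrite /rot_sum => ->.
by rewrite sumr_const card_ord; ring.
Qed.

Lemma rot_philogN (t : R) : rot_sum q philog (- t) = rot_sum q philog t.
Proof.
by rewrite rot_sumN//; apply: eq_bigr => j _; rewrite /philog cosN.
Qed.

(** The rotated sum is odd with period [2 * pi / q], so it also vanishes at half periods. *)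
Lemma rot_slog_eq0 (k : nat) : rot_sum q slog (pi / q%:R * k%:R) = 0 :> R.
Proof.
have h : rot_sum q slog (- (pi / q%:R * k%:R : R)) = - rot_sum q slog (pi / q%:R *
  k%:R).
  rewrite rot_sumN// /rot_sum -sumrN; apply: eq_bigr => j _.
  by rewrite /slog sinN cosN mulNr.
have := rot_sum_periodic_nat (- (pi / q%:R * k%:R)) k q0 slog2pi.
rewrite h (_ : - _ + _ = pi / q%:R * k%:R); last by field.
by move=> ?; lra.
Qed.

(** Here [q * t / 2] stays in []0, pi / 2[], where the sine is positive and increasing, so
    [log_rot_sum] increases and [oscillator_comparison] applies with [L = pi / q]. *)
Lemma rot_slog_ge0 (x : R) : 0 < x < pi / q%:R -> 0 <= rot_sum q slog x.
Proof.
have q4 : 4 <= q%:R :> R by rewrite ler_nat.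
have sne (t : R) : 0 < t < pi / q%:R -> 0 < q%:R * t / 2 < pi / 2.
  move=> /andP[t0 tq]; rewrite divr_gt0 ?mulr_gt0//= ltr_pM2r//.
  by rewrite mulrC -ltr_pdivlMr.
have sgt (t : R) : 0 < t < pi / q%:R -> 0 < sin (q%:R * t / 2).
  by move=> /sne; exact: sin_gt0_pihalf.
apply: (@oscillator_comparison R (rot_sum q philog) (rot_sum q slog) log_rot_sum
  (pi / q%:R)).
- by rewrite ler_pM2l// lef_pV2 ?posrE//; lra.
- by apply: continuous_rot_sum; exact: continuous_philog.
- by apply: continuous_rot_sum; exact: continuous_slog.
- by have := rot_slog_eq0 0; rewrite mulr0.
- by have := rot_slog_eq0 1; rewrite mulr1.
- by move=> t /sgt t0; apply: is_derive_rot_philog; rewrite lt0r_neq0.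
- by move=> t /sgt t0; apply: is_derive_rot_slog; rewrite lt0r_neq0.
- move=> s t s0; rewrite le_eqVlt => /predU1P[-> //|st] tL.
  have s1 : 0 < s < pi / q%:R by rewrite s0 (lt_trans st).
  have t1 : 0 < t < pi / q%:R by rewrite tL (lt_trans s0).
  rewrite lerD2l ler_ln ?posrE ?exprn_gt0 ?sgt//.
  rewrite ler_pXn2r ?nnegrE ?ltW ?sgt// ltr_sin ?in_itv/=.
  + by rewrite ltr_pM2r// ltr_pM2l.
  + by have /andP[? ?] := sne _ s1; apply/andP; split; lra.
  + by have /andP[? ?] := sne _ t1; apply/andP; split; lra.
Qed.

(** On [[0, pi / q]] the derivative is [- rot_sum q slog], hence nonpositive; evenness and the
    period [2 * pi / q] bring every [t] into that interval. *)
Lemma rot_philog_max (t : R) : rot_sum q philog t <= rot_sum q philog 0.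
Proof.
have half (x : R) : 0 <= x <= pi / q%:R -> rot_sum q philog x <= rot_sum q philog 0.
  move=> /andP[x0 xq]; rewrite -lerN2.
  apply: (@nondecr_of_derive _ (fun t => - rot_sum q philog t) (rot_sum q slog)) => //.
  - move=> s /andP[s0 sx].
    rewrite -[X in is_derive _ _ _ X]opprK; apply: is_deriveN.
    apply: is_derive_rot_philog; rewrite lt0r_neq0//.
    apply: sin_gt0_pihalf; rewrite divr_gt0 ?mulr_gt0//= ltr_pM2r//.
    by rewrite mulrC -ltr_pdivlMr// (lt_le_trans sx).
  - by move=> s; apply: cvgN; apply: continuous_rot_sum; exact: continuous_philog.
  - by move=> s /andP[s0 sx]; apply: rot_slog_ge0; rewrite s0 (lt_le_trans sx).
wlog t0 : t / 0 <= t.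
  move=> w; have [/w//|t0] := leP 0 t.
  by rewrite -rot_philogN w// oppr_ge0 ltW.
have P0 : 0 < 2 * pi / q%:R :> R by rewrite divr_gt0// mulr_gt0.
pose m := Num.trunc (t / (2 * pi / q%:R)).
have /andP[m1 m2] : m%:R <= t / (2 * pi / q%:R) < m.+1%:R.
  by apply: truncn_itv; rewrite divr_ge0// ltW.
rewrite ler_pdivlMr// in m1; rewrite ltr_pdivrMr// in m2.
pose r := t - 2 * pi / q%:R * m%:R.
have -> : rot_sum q philog t = rot_sum q philog r.
  by rewrite -[RHS](rot_sum_periodic_nat _ m q0 phi2pi) /r subrK.
have r0 : 0 <= r by rewrite /r subr_ge0 mulrC.
have r1 : r < 2 * pi / q%:R.
  by rewrite /r ltrBlDr -[X in X + _]mulr1 -mulrDr nat1r mulrC.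
have [rq|rq] := leP r (pi / q%:R); first by apply: half; rewrite r0.
(* Past half a period, [r] is replaced by [2 * pi / q - r]. *)
rewrite -rot_philogN -(rot_sum_periodic _ q0 phi2pi).
by apply: half; move: r1 rq; rewrite -mulrA => *; apply/andP; split; lra.
Qed.

End RotatedEntropy.
(** * The integral with logarithmic singularities *)

(** Since [g] may blow up at both ends, the fundamental theorem is applied on an increasing sequence
    of compact subintervals, followed by monotone convergence. *)
Lemma integral_le_primitive (R : realType) (g G : R -> R) (a b : R) :
  a <= b -> continuous G -> measurable_fun [set: R] g ->
  (forall x, a <= x <= b -> 0 <= g x) ->
  (forall x : R, a < x < b -> is_derive x 1 G (g x)) ->
  (forall x : R, a < x < b -> {for x, continuous g}) ->
  (\int[lebesgue_measure]_(x in `[a, b]) (g x)%:E <= (G b - G a)%:E)%E.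
Proof.
rewrite le_eqVlt => /predU1P[->|ab] cG mg g0 dG cg.
  by rewrite set_itv1 integral_set1 subrr.
(* The shift to [n.+3] keeps [d n] below half the length already for [n = 0]. *)
pose d n : R := (b - a) / n.+3%:R.
have ba : 0 < b - a by rewrite subr_gt0.
have d0 n : 0 < d n by rewrite divr_gt0.
have dh n : a + d n < b - d n.
  have : d n < (b - a) / 2 by rewrite ltr_pM2l// ltf_pV2 ?posrE// ltr_nat.
  by lra.
rewrite -integral_itv_bndo_bndc; last exact/measurable_EFinP/measurable_funTS.
rewrite -integral_itv_obnd_cbnd; last exact/measurable_EFinP/measurable_funTS.
pose F n := `[a + d n, b - d n]%classic : set R.
have -> : `]a, b[%classic = \bigcup_n F n.
  apply/seteqP; split => x /=; rewrite in_itv/=.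
    move=> /andP[ax xb].
    have e0 : 0 < Num.min (x - a) (b - x) by rewrite lt_min !subr_gt0 ax.
    pose n := Num.trunc ((b - a) / Num.min (x - a) (b - x)).
    have : d n <= Num.min (x - a) (b - x).
      rewrite ler_pdivrMr// mulrC -ler_pdivrMr//.
      have /andP[_ h] := truncn_itv (ltW (divr_gt0 ba e0)).
      by apply: (le_trans (ltW h)); rewrite ler_nat ltnS; exact: leqW (leqnSn _).
    rewrite le_min => /andP[h1 h2]; exists n => //.
    by rewrite /F/= in_itv/=; apply/andP; split; lra.
  move=> [n _]; rewrite /F/= in_itv/= => /andP[h1 h2].
  by have := d0 n => ?; apply/andP; split; lra.
have ndF : nondecreasing_seq F.
  move=> m n mn; apply/subsetPset => x; rewrite /F/= !in_itv/= => /andP[h1 h2].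
  have : d n <= d m by rewrite ler_pM2l// lef_pV2 ?posrE// ler_nat.
  by move=> ?; apply/andP; split; lra.
have Gle x y : a <= x -> x <= y -> y <= b -> G x <= G y.
  move=> ax xy yb; apply: (@nondecr_of_derive _ _ g) => // t /andP[xt ty].
    by apply: dG; rewrite (le_lt_trans ax)// (lt_le_trans ty).
  by apply: g0; rewrite (le_trans ax (ltW xt)) (le_trans (ltW ty) yb).
have cvgF : (\int[lebesgue_measure]_(x in F n) (g x)%:E @[n --> \oo] -->
    \int[lebesgue_measure]_(x in \bigcup_n F n) (g x)%:E)%E.
  apply: ge0_nondecreasing_set_cvg_integral => //.
  - by move=> n; exact: measurable_itv.
  - by move=> n; exact/measurable_EFinP/measurable_funTS.
  - move=> n x; rewrite /F/= in_itv/= => /andP[h1 h2]; rewrite lee_fin g0//.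
    by have := d0 n => ?; apply/andP; split; lra.
(* [G] is nondecreasing because [g] is nonnegative, so its increment over each [F n] is at most the
   full one. *)
apply: (cvge_to_le cvgF); apply: nearW => n.
have dn := d0 n; have dhn := dh n.
rewrite (continuous_FTC2 dhn (F := G)).
- by rewrite -EFinB lee_fin lerB// Gle//; lra.
- apply/continuous_in_subspaceT => x; rewrite inE/= in_itv/= => /andP[h1 h2].
  by apply: cg; apply/andP; split; lra.
- split.
  + move=> x; rewrite in_itv/= => /andP[h1 h2].
    have axb : a < x < b by apply/andP; split; lra.
    by case: (dG _ axb).
  + by apply: cvg_at_right_filter; exact: cG.
  + by apply: cvg_at_left_filter; exact: cG.
- move=> x; rewrite in_itv/= => /andP[h1 h2].
  have axb : a < x < b by apply/andP; split; lra.
  by rewrite derive1E; apply: (@derive_val _ _ _ _ _ _ _ (dG _ axb)).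
Qed.

(** Allows singularities of [g] at all the points [c + h *+ k]: the estimates for the successive
    segments telescope by continuity of [G]. *)
Lemma integral_le_primitive_chain (R : realType) (g G : R -> R) (c h : R) (n : nat) :
  0 <= h -> continuous G -> measurable_fun [set: R] g ->
  (forall x, c <= x <= c + h *+ n -> 0 <= g x) ->
  (forall (k : nat) (x : R), (k < n)%N -> c + h *+ k < x < c + h *+ k.+1 ->
    is_derive x 1 G (g x) /\ {for x, continuous g}) ->
  (\int[lebesgue_measure]_(x in `[c, (c + h *+ n)%R]) (g x)%:E <=
   (G (c + h *+ n) - G c)%:E)%E.
Proof.
move=> h0 cG mg; elim: n => [|n IH] g0 dg.
  by rewrite mulr0n addr0 set_itv1 integral_set1 subrr.
have hn m : (m <= n.+1)%N -> c + h *+ m <= c + h *+ n.+1.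
  by move=> mn; rewrite lerD2l ler_wpMn2l.
have cn : c <= c + h *+ n by rewrite lerDl mulrn_wge0.
have nS := hn n (leqnSn n).
rewrite (@itv_bndbnd_setU _ _ _ (BRight (c + h *+ n))) ?bnd_simp//.
rewrite ge0_integral_setU//=.
- rewrite integral_itv_obnd_cbnd; last exact/measurable_EFinP/measurable_funTS.
  rewrite (_ : G _ - G c = (G (c + h *+ n) - G c) + (G (c + h *+ n.+1) - G (c + h
    *+ n))); last by ring.
  rewrite EFinD; apply: leeD.
    apply: IH => [x /andP[x1 x2]|k x kn]; last by apply: dg; exact: leqW.
    by apply: g0; rewrite x1 (le_trans x2).
  apply: integral_le_primitive => //.
  + by move=> x /andP[x1 x2]; apply: g0; rewrite x2 (le_trans cn).
  + by move=> x xn; apply: (dg n x _ xn).1.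
  + by move=> x xn; apply: (dg n x _ xn).2.
- by apply/measurable_EFinP/measurable_funTS.
- move=> x /= [|]; rewrite in_itv/= => /andP[x1 x2]; rewrite lee_fin g0//.
    by rewrite x1 (le_trans x2).
  by rewrite x2 (le_trans cn)// ltW.
- apply/disj_setPS => x [] /=; rewrite !in_itv/= => /andP[_ x1] /andP[x2 _].
  by move: x2; rewrite ltNge x1.
Qed.

(** * Convexity and the bound on the mean entropy *)

(** The tangent line at the barycentre [z] lies below the graph; its values at [x] and [y] are
    averaged. The value 0 of [x * ln x] at 0 is included. *)
Lemma xlnx_convex (R : realType) (p x y : R) : 0 <= p <= 1 -> 0 <= x -> 0 <= y ->
  (p * x + (1 - p) * y) * ln (p * x + (1 - p) * y) <=
  p * (x * ln x) + (1 - p) * (y * ln y).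
Proof.
move=> /andP[p0 p1] x0 y0; set z := p * x + _.
have z0 : 0 <= z by rewrite addr_ge0// mulr_ge0// subr_ge0.
have [z0E|zn0] := eqVneq z 0.
  have px : p * x = 0 by apply/eqP;
    rewrite eq_le mulr_ge0// andbT -z0E lerDl mulr_ge0// subr_ge0.
  have py : (1 - p) * y = 0 by apply/eqP;
    rewrite eq_le mulr_ge0 ?subr_ge0// andbT -z0E lerDr mulr_ge0.
  by rewrite {1}z0E mul0r !mulrA px py !mul0r addr0.
have zp : 0 < z by rewrite lt0r zn0.
(* For [w > 0] this is [ln (z / w) <= z / w - 1] multiplied by [w]. *)
have tangent w : 0 <= w -> z * ln z + (1 + ln z) * (w - z) <= w * ln w.
  rewrite le_eqVlt => /predU1P[<-|w0]; first by rewrite mul0r; nra.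
  have := le_ln1Dx (x := z / w - 1).
  rewrite addrCA subrr addr0 => h.
  have {}h := h _.
  have : ln (z / w) <= z / w - 1 by apply: h; rewrite ltrBDl subrr divr_gt0.
  rewrite ln_div ?posrE// => {}h.
  have := ler_wpM2l (ltW w0) h.
  rewrite mulrBr mulrBr mulrCA mulfV ?lt0r_neq0// !mulr1; lra.
have hx := ler_wpM2l p0 (tangent x x0).
have hy := ler_wpM2l (_ : 0 <= 1 - p) (tangent y y0).
have {}hy := hy _; rewrite subr_ge0 in hy; have {}hy := hy p1.
apply: le_trans (lerD hx hy); rewrite le_eqVlt; apply/orP; left; apply/eqP.
by move: (ln z) => l; rewrite /z; ring.
Qed.

Section EntropyBound.
Context {R : realType} (q : nat) (q_even : ~~ odd q) (q_ge4 : (4 <= q)%N).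

Let q0 : (0 < q)%N. Proof. by case: q q_ge4. Qed.
Let qp : 0 < q%:R :> R. Proof. by rewrite ltr0n. Qed.
Let qn0 : q%:R != 0 :> R. Proof. by rewrite lt0r_neq0. Qed.
Let p0 : 0 < pi :> R. Proof. exact: pi_gt0. Qed.
Let q4 : 4 <= q%:R :> R. Proof. by rewrite ler_nat. Qed.

(** [1 + a * cos s] is the mixture of [1 + cos s] and [1 + cos (s + pi)] with weights [p] and
    [1 - p], and for even [q] the shift by [pi] leaves rotated sums unchanged. *)
Lemma rot_sum_entropy_le (a t : R) : -1 <= a <= 1 ->
  rot_sum q (fun s => (1 + a * cos s) * ln (1 + a * cos s)) t <=
  rot_sum q philog 0.
Proof.
move=> /andP[a1 a2]; pose p := (1 + a) / 2.
have p01 : 0 <= p <= 1 by rewrite /p; apply/andP; split; lra.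
have le_mix s : (1 + a * cos s) * ln (1 + a * cos s) <=
    p * philog s + (1 - p) * philog (s + pi).
  rewrite /philog cosDpi.
  have -> : 1 + a * cos s = p * (1 + cos s) + (1 - p) * (1 - cos s).
    by rewrite /p; field.
  by apply: xlnx_convex.
apply: le_trans (_ : p * rot_sum q philog t + (1 - p) * rot_sum q philog (t + pi) <= _).
  rewrite /rot_sum !mulr_sumr -big_split/=; apply: ler_sum => j _.
  by apply: le_trans (le_mix _) _; rewrite (addrAC t _ pi).
rewrite rot_sum_pi//; last by move=> s; rewrite /philog mulr_natl cosD2pi.
by rewrite -mulrDl addrC subrK mul1r; exact: rot_philog_max.
Qed.

(** Minus the integrand of the statement, hence nonnegative on the interval of integration. *)
Let g (z : R) : R := - (ln (cos z ^+ 2) * sin (2 * z / q%:R)).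
Let kap : R := q%:R + (2 - q%:R) * ln 2.
(** The change of variable [t = 2 z / q - pi / q]: the range from [pi / 2] to [q * pi / 4] becomes
    that from 0 to [pi / 2 - pi / q], and [q * t / 2 = z - pi / 2]. *)
Let tz (z : R) : R := 2 * z / q%:R - pi / q%:R.
(** A primitive of [g] off the zeros of [cos], of Wronskian type: in the derivative of
    [T * sin + (S - kap) * cos] the terms in [S] and [T] cancel and only [kap - log_rot_sum] times
    [sin] remains. *)
Let G (z : R) : R := q%:R / 2 * (rot_sum q slog (tz z) * sin (2 * z / q%:R)
  + (rot_sum q philog (tz z) - kap) * cos (2 * z / q%:R)).

Let scale_continuous : continuous (fun z : R => 2 * z / q%:R).
Proof.
by move=> z; apply: cvgM; [apply: cvgM; [exact: cvg_cst|exact: cvg_id]|exact: cvg_cst].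
Qed.

Let tz_continuous : continuous tz.
Proof. by move=> z; apply: cvgB; [exact: scale_continuous|exact: cvg_cst]. Qed.

Let G_continuous : continuous G.
Proof.
move=> z; apply: cvgM; first exact: cvg_cst.
apply: cvgD; apply: cvgM.
- apply: (continuous_comp (f := tz) (g := rot_sum q slog)); first exact: tz_continuous.
  by apply: continuous_rot_sum; exact: continuous_slog.
- apply: (continuous_comp (f := fun z : R => 2 * z / q%:R) (g := @sin R)).
    exact: scale_continuous.
  exact: continuous_sin.
- apply: cvgB; last exact: cvg_cst.
  apply: (continuous_comp (f := tz) (g := rot_sum q philog));
    first exact: tz_continuous.
  by apply: continuous_rot_sum; exact: continuous_philog.
- apply: (continuous_comp (f := fun z : R => 2 * z / q%:R) (g := @cos R)).
    exact: scale_continuous.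
  exact: continuous_cos.
Qed.

Let sin_tz z : sin (q%:R * tz z / 2) = - cos z.
Proof. by rewrite (_ : _ / 2 = z - pi / 2) ?sinBpihalf// /tz; field. Qed.

Let is_derive_G (z : R) : cos z != 0 -> is_derive z 1 G (g z).
Proof.
move=> cz.
have s0 : sin (q%:R * tz z / 2) != 0 by rewrite sin_tz oppr_eq0.
have dsc : is_derive z 1 (fun z : R => 2 * z / q%:R) (2 / q%:R).
  rewrite (_ : (fun z : R => _) = (fun z => (2 / q%:R) * z)); last first.
    by apply/funext => y; rewrite mulrAC.
  have := @is_deriveM R _ (fun=> 2 / q%:R) id z 1 0 1 (is_derive_cst _ _ _)
    (is_derive_id _ _).
  by rewrite /GRing.scale/= mulr1 mulr0 addr0.
have dtz : is_derive z 1 tz (2 / q%:R).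
  by rewrite -[X in is_derive _ _ _ X]subr0; apply: is_deriveB.
have dS := @is_derive1_comp R _ _ _ _ _ (is_derive_rot_philog q_even q_ge4 s0) dtz.
have dT := @is_derive1_comp R _ _ _ _ _ (is_derive_rot_slog q_even q_ge4 s0) dtz.
have dsin := @is_derive1_comp R (@sin R) (fun z => 2 * z / q%:R) z _ _
  (is_derive_sin (2 * z / q%:R)) dsc.
have dcos := @is_derive1_comp R (@cos R) (fun z => 2 * z / q%:R) z _ _
  (is_derive_cos (2 * z / q%:R)) dsc.
have D1 := is_deriveM dT dsin.
have D2 := is_deriveM (is_deriveB dS (is_derive_cst kap z 1)) dcos.
have D := is_deriveM (is_derive_cst (q%:R / 2 : R) z 1) (is_deriveD D1 D2).
move: D; set d := (X in is_derive _ _ _ X -> _).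
suff -> : d = g z by [].
rewrite /d /g /log_rot_sum sin_tz sqrrN -/kap.
have -> : (rot_sum q philog \o tz - cst kap) z = rot_sum q philog (tz z) - kap by [].
rewrite /GRing.scale/= mulr0 addr0.
move: (ln (cos z ^+ 2)) (rot_sum q slog (tz z)) (rot_sum q philog (tz z)) kap.
by move: (sin (2 * z / q%:R)) (cos (2 * z / q%:R)) => s c l T S k; field.
Qed.

(** Steps of [pi / 2] are taken because the upper limit [q * pi / 4] is a multiple of [pi / 2], not
    always an odd one. Between such points [sin (2 x)] does not vanish. *)
Let cos_gap (k : nat) (x : R) :
  pi / 2 + pi / 2 *+ k < x < pi / 2 + pi / 2 *+ k.+1 -> cos x != 0.
Proof.
move=> /andP[x1 x2]; have : sin (x *+ 2) != 0.
  rewrite -(subrK (pi *+ k.+1) (x *+ 2)) (alternatingn (@sinDpi R)).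
  rewrite mulf_neq0 ?signr_eq0// lt0r_neq0//; apply: sin_gt0_pi.
  move: x1 x2; rewrite !(mulrS _ k) -(mulr_natl (pi / 2) k) -(mulr_natl pi k) => x1 x2.
  by apply/andP; split; lra.
by rewrite sin_mulr2n; apply: contraNneq => ->; rewrite mul0r mul0rn.
Qed.

Let q_half : q%:R = (q./2)%:R * 2 :> R.
Proof.
by rewrite -natrM muln2; congr (_%:R); rewrite -[LHS]odd_double_half (negbTE q_even).
Qed.

Let g_measurable : measurable_fun [set: R] g.
Proof.
apply: measurableT_comp => //; apply: measurable_funM.
  apply: (measurableT_comp (@measurable_ln R)).
  by apply: measurable_funX; apply: continuous_measurable_fun; exact: continuous_cos.
apply: (measurableT_comp (f := @sin R)).
  by apply: continuous_measurable_fun; exact: continuous_sin.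
by apply: continuous_measurable_fun; exact: scale_continuous.
Qed.

Let end_pt : (pi / 2 + pi / 2 *+ (q./2).-1 : R) = q%:R * pi / 4.
Proof.
have h : (0 < q./2)%N by rewrite half_gt0; case: q q_ge4 => [|[|]].
by rewrite -mulrS prednK// -[LHS]mulr_natl q_half; field.
Qed.

Let sin_ge0 (z : R) : pi / 2 <= z <= q%:R * pi / 4 -> 0 <= sin (2 * z / q%:R).
Proof.
have pi0 := pi_gt0 R; move=> /andP[z1 z2]; apply: sin_ge0_pi; apply/andP; split.
  by rewrite divr_ge0 ?mulr_ge0 ?ltW//; lra.
by rewrite ler_pdivrMr//; nra.
Qed.

(** The integral of [g] is at most [G (q * pi / 4) - G (pi / 2)]. The first value is 0, as both
    [cos (pi / 2)] and the rotated sum of [slog] at a multiple of [pi / q] vanish; the second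
    contains the rotated sum of [philog] at 0 times [cos (pi / q)]. *)
Lemma integral_log_cos_ge :
  rot_sum q philog (0 : R) - (q%:R + (2 - q%:R) * ln 2) <=
  2 / (q%:R * cos (pi / q%:R)) *
       \int[lebesgue_measure]_(z in `[pi / 2, q%:R * pi / 4])
         (ln (cos z ^+ 2) * sin (2 * z / q%:R)).
Proof.
have pi0 := pi_gt0 R; have q4' := q4.
have cpos : 0 < cos (pi / q%:R) :> R.
  apply: cos_gt0_pihalf; apply/andP; split.
    by apply: (@lt_trans _ _ 0); [lra|exact: divr_gt0].
  by rewrite ltr_pM2l// ltf_pV2 ?posrE//; lra.
have hI : (\int[lebesgue_measure]_(z in `[(pi / 2)%R, (q%:R * pi / 4)%R]) (g z)%:E <=
    (G (q%:R * pi / 4) - G (pi / 2))%:E)%E.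
  rewrite -end_pt; apply: (@integral_le_primitive_chain R g G (pi / 2) (pi / 2)
    (q./2).-1).
  - by rewrite divr_ge0// ltW.
  - exact: G_continuous.
  - exact: g_measurable.
  - move=> x; rewrite end_pt => xb; rewrite oppr_ge0 mulr_le0_ge0 ?sin_ge0//.
    by apply: ln_le0; rewrite cos2sin2 gerBl sqr_ge0.
  - move=> k x _ /cos_gap cx; split; first exact: is_derive_G.
    apply: cvgN; apply: cvgM.
      apply: (continuous_comp (f := fun x : R => cos x ^+ 2) (g := @ln R)).
        apply: (continuous_comp (f := @cos R) (g := fun y : R => y ^+ 2)).
          exact: continuous_cos.
        exact: exprn_continuous.
      by apply: continuous_ln; rewrite exprn_even_gt0.
    apply: (continuous_comp (f := fun z : R => 2 * z / q%:R) (g := @sin R)).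
      exact: scale_continuous.
    exact: continuous_sin.
have Gb : G (q%:R * pi / 4) = 0.
  rewrite /G (_ : 2 * (q%:R * pi / 4) / q%:R = pi / 2); last by field.
  rewrite cos_pihalf mulr0 addr0 (_ : tz _ = pi / q%:R * (q./2).-1%:R).
    by rewrite rot_slog_eq0// mul0r mulr0.
  rewrite /tz -subn1 natrB; last by rewrite half_gt0; case: q q_ge4 => [|[|]].
  by have := qn0; rewrite q_half => ?; field; lra.
have Ga : G (pi / 2) = q%:R / 2 * ((rot_sum q philog 0 - kap) * cos (pi / q%:R)).
  rewrite /G (_ : 2 * (pi / 2) / q%:R = pi / q%:R); last by field.
  rewrite (_ : tz _ = 0); last by rewrite /tz; field.
  by have := @rot_slog_eq0 R q q_ge4 0; rewrite mulr0 => ->; rewrite mul0r add0r.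
rewrite Gb sub0r Ga in hI.
have hR : \int[lebesgue_measure]_(z in `[pi / 2, q%:R * pi / 4])
         (ln (cos z ^+ 2) * sin (2 * z / q%:R)) >= q%:R / 2 * ((rot_sum q philog 0
           - kap) * cos (pi / q%:R)).
  (* Nonnegativity excludes [-oo], where [fine] takes the value 0. *)
  have fine_leR (X : \bar R) (c : R) : (0 <= X)%E -> (X <= c%:E)%E -> fine X <= c.
    by case: X => [r| |]//; rewrite !lee_fin.
  have g0 (z : R) : z \in `[pi / 2, q%:R * pi / 4] -> 0 <= g z.
    rewrite in_itv/= => zb; rewrite oppr_ge0 mulr_le0_ge0 ?sin_ge0//.
    by apply: ln_le0; rewrite cos2sin2 gerBl sqr_ge0.
  have -> : \int[lebesgue_measure]_(z in `[pi / 2, q%:R * pi / 4])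
         (ln (cos z ^+ 2) * sin (2 * z / q%:R)) =
      - fine (\int[lebesgue_measure]_(z in `[(pi / 2)%R, (q%:R * pi / 4)%R]) (g
        z)%:E)%E.
    rewrite /Rintegral -fineN -integral_ge0N; last by move=> z zb; rewrite lee_fin g0.
    by congr fine; apply: eq_integral => z _; rewrite -EFinN /g opprK.
  rewrite -lerN2 opprK; apply: fine_leR => //.
  by apply: integral_ge0 => z zb; rewrite lee_fin g0.
rewrite [leRHS]mulrAC ler_pdivlMr ?mulr_gt0// -/kap.
rewrite (_ : _ * (q%:R * _) = q%:R / 2 * ((rot_sum q philog 0 - kap) * cos (pi /
  q%:R)) * 2); last by field.
by rewrite [leRHS]mulrC ler_pM2r.
Qed.

Lemma mean_entropy_le (a t : R) : -1 <= a <= 1 ->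
  rot_sum q (fun s => (1 + a * cos s) * ln (1 + a * cos s)) t / q%:R <=
  1 - ln 2 + 1 / q%:R * (2 * ln 2 + 2 / (q%:R * cos (pi / q%:R)) *
       \int[lebesgue_measure]_(z in `[pi / 2, q%:R * pi / 4])
         (ln (cos z ^+ 2) * sin (2 * z / q%:R))).
Proof.
move=> /(rot_sum_entropy_le t) h; have := integral_log_cos_ge.
set J := 2 / _ * _ => hJ; rewrite ler_pdivrMr// (le_trans h)//.
rewrite (_ : _ * q%:R = J + (q%:R + (2 - q%:R) * ln 2)); last by field.
by rewrite -lerBlDr.
Qed.

End EntropyBound.
(** * Averaging over the preimages of x -> N x *)

Lemma continuous_compR (R : realType) (f g : R -> R) :
  continuous f -> continuous g -> continuous (fun x => g (f x)).
Proof. by move=> cf cg x; apply: continuous_comp; [exact: cf|exact: cg]. Qed.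

Section Averaging.
Context {R : realType}.
Implicit Types (h G : R -> R) (N : nat).
Local Notation mu := (@lebesgue_measure R).

(** Mean over the [N] preimages of [y] under [x -> N x] modulo 1. With [riesz_factor] included in
    [h] this is the transfer operator of the Riesz product. *)
Definition fold_mean N h (y : R) : R :=
  (\sum_(j < N) h ((y + j%:R) / N%:R)) / N%:R.

Lemma continuous_integrable01 h a b : continuous h ->
  mu.-integrable `[a, b] (EFin \o h).
Proof.
move=> ch; apply: continuous_compact_integrable; first exact: segment_compact.
exact: continuous_subspaceT.
Qed.

Let affine_continuous (N j : nat) : continuous (fun y : R => (y + j%:R) / N%:R).
Proof.
by move=> y; apply: cvgM; [apply: cvgD; [exact: cvg_id|exact: cvg_cst]|exact: cvg_cst].
Qed.

Let fold_sum_continuous (N k : nat) h : continuous h ->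
  continuous (fun y : R => \sum_(j < k) h ((y + j%:R) / N%:R) / N%:R).
Proof.
move=> ch; apply: continuous_big; first exact: add_continuous.
move=> i _ y; apply: cvgM; last exact: cvg_cst.
exact: (continuous_compR (@affine_continuous N _) ch).
Qed.

Let Rintegral_segment N (j : nat) h : (0 < N)%N -> continuous h ->
  \int[mu]_(x in `[j%:R / N%:R, j.+1%:R / N%:R]) h x =
  \int[mu]_(y in `[0, 1]) (h ((y + j%:R) / N%:R) / N%:R).
Proof.
move=> N0 ch; have Np : 0 < N%:R :> R by rewrite ltr0n.
pose F (y : R) : R := (y + j%:R) / N%:R.
have dF (y : R) : is_derive y 1 F N%:R^-1.
  have := @is_deriveM R _ (fun y : R => y + j%:R) (fun=> N%:R^-1) y 1 1 0.
  rewrite /GRing.scale/= mulr0 add0r mulr1; apply.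
  by rewrite -[X in is_derive _ _ _ X]addr0; apply: is_deriveD.
have F' : derive1 F = fun=> N%:R^-1.
  by apply/funext => y; rewrite derive1E; apply: (@derive_val _ _ _ _ _ _ _ (dF y)).
have := @integration_by_substitution_increasing R F h 0 1 ler01.
have F0 : F 0 = j%:R / N%:R by rewrite /F add0r.
have F1 : F 1 = j.+1%:R / N%:R by rewrite /F nat1r.
rewrite F' F0 F1.
rewrite /Rintegral => -> //.
- by move=> x y _ _ xy; rewrite /F ltr_pM2r ?invr_gt0// ltrD2r.
- by move=> x _; exact: cvg_cst.
- exact: is_cvg_cst.
- exact: is_cvg_cst.
- split.
  + by move=> x _; case: (dF x).
  + by apply: cvg_at_right_filter; exact: affine_continuous.
  + by apply: cvg_at_left_filter; exact: affine_continuous.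
- exact: continuous_subspaceT.
Qed.

Let Rintegral_segments N (k : nat) h : (0 < N)%N -> continuous h ->
  \int[mu]_(x in `[0, k%:R / N%:R]) h x =
  \int[mu]_(y in `[0, 1]) \sum_(j < k) h ((y + j%:R) / N%:R) / N%:R.
Proof.
move=> N0 ch; have Np : 0 < N%:R :> R by rewrite ltr0n.
elim: k => [|k IH].
  rewrite mul0r set_itv1 Rintegral_set1.
  by under eq_Rintegral do rewrite big_ord0; rewrite Rintegral_cst// mul0r.
under [RHS]eq_Rintegral do rewrite big_ord_recr/=.
rewrite RintegralD//; last 2 first.
- by apply: continuous_integrable01; exact: fold_sum_continuous.
- apply: continuous_integrable01 => y; apply: cvgM; last exact: cvg_cst.
  exact: (continuous_compR (@affine_continuous N _) ch).
rewrite -IH -Rintegral_segment//.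
have kk : k%:R / N%:R <= k.+1%:R / N%:R :> R by rewrite ler_pM2r ?invr_gt0// ler_nat.
have k0 : 0 <= k%:R / N%:R :> R by rewrite divr_ge0.
apply/eqP; rewrite addrC -subr_eq; apply/eqP.
rewrite Rintegral_itvB ?bnd_simp//; last exact: continuous_integrable01.
rewrite Rintegral_itv_obnd_cbnd//.
by apply: integrableS (continuous_integrable01 (k%:R / N%:R) (k.+1%:R / N%:R) ch)
  => //; exact: subset_itv_oc_cc.
Qed.

Lemma periodic1_nat G (x : R) (k : nat) : (forall y, G (y + 1) = G y) ->
  G (x + k%:R) = G x.
Proof.
by move=> Gp; elim: k => [|k IH]; [rewrite addr0|rewrite -natr1 addrA Gp].
Qed.

(** Cut [[0, 1]] into [N] equal segments and substitute [x = (y + j) / N] on the segment of index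
    [j]; then [G (N x) = G (y + j) = G y]. *)
Lemma Rintegral_fold N h G : (0 < N)%N -> continuous h -> continuous G ->
  (forall y, G (y + 1) = G y) ->
  \int[mu]_(x in `[0, 1]) (h x * G (N%:R * x)) =
  \int[mu]_(y in `[0, 1]) (fold_mean N h y * G y).
Proof.
move=> N0 ch cG Gp; have Nn : N%:R != 0 :> R by rewrite pnatr_eq0 -lt0n.
have cH : continuous (fun x => h x * G (N%:R * x)).
  move=> x; apply: cvgM; first exact: ch.
  apply: (@continuous_compR _ (fun x => N%:R * x) G) => // {}x.
  by apply: cvgM; [exact: cvg_cst|exact: cvg_id].
have := Rintegral_segments N N0 cH; rewrite divff// => ->.
apply: eq_Rintegral => y _; rewrite /fold_mean mulr_suml mulr_suml.
apply: eq_bigr => j _.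
have -> : N%:R * ((y + j%:R) / N%:R) = y + j%:R by rewrite mulrC divfK.
by rewrite periodic1_nat// mulrAC.
Qed.

Lemma Rintegral_fold_le N h G (M : R) : (0 < N)%N -> continuous h -> continuous G ->
  (forall y, G (y + 1) = G y) -> (forall y, 0 <= G y) ->
  (forall y, fold_mean N h y <= M) ->
  \int[mu]_(x in `[0, 1]) (h x * G (N%:R * x)) <= M * \int[mu]_(y in `[0, 1]) G y.
Proof.
move=> N0 ch cG Gp G0 hM; rewrite Rintegral_fold//.
rewrite -RintegralZl//; last exact: continuous_integrable01.
apply: le_Rintegral => //.
- apply: continuous_integrable01 => y; apply: cvgM; last exact: cG.
  rewrite /continuous_at /fold_mean mulr_suml.
  under eq_fun do rewrite mulr_suml.
  exact: fold_sum_continuous.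
- by apply: continuous_integrable01 => y; apply: cvgM; [exact: cvg_cst|exact: cG].
- by move=> y _; apply: ler_wpM2r.
Qed.

End Averaging.
(** * Functions on the circle *)

Section DistInt.
Context {R : realType}.
Implicit Types (r s d : R).

Lemma dist_int_le_norm r : dist_int r <= `|r|.
Proof. by have := dist_int_le r 0; rewrite subr0. Qed.

Lemma dist_intB_le r s : `|dist_int r - dist_int s| <= `|r - s|.
Proof.
rewrite ler_distl; apply/andP; split.
  rewrite lerBlDr -{1}(subrK r s); apply: le_trans (dist_intD _ _) _.
  by rewrite addrC lerD2l distrC dist_int_le_norm.
rewrite -{1}(subrK s r); apply: le_trans (dist_intD _ _) _.
by rewrite addrC lerD2l dist_int_le_norm.
Qed.

Lemma dist_int_lt r d : dist_int r < d -> exists n : int, `|r - n%:~R| < d.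
Proof.
move=> rd; apply: contrapT => h; suff : d <= dist_int r by rewrite leNgt rd.
by apply: dist_int_ge => n; rewrite leNgt; apply/negP => nd; apply: h; exists n.
Qed.

Lemma dist_intD1 r : dist_int (r + 1) = dist_int r.
Proof. by apply: dist_int_congr; rewrite addrAC subrr add0r rpred1. Qed.

Lemma dist_int_mulrn r (k : nat) : dist_int (k%:R * r) <= k%:R * dist_int r.
Proof.
case: k => [|k]; first by rewrite !mul0r (dist_intz 0).
have k0 : 0 < k.+1%:R :> R by rewrite ltr0n.
rewrite [leRHS]mulrC -ler_pdivrMr//; apply: dist_int_ge => n; rewrite ler_pdivrMr//.
apply: (le_trans (dist_int_le _ (k.+1%:Z * n))).
by rewrite intrM -pmulrn -mulrBr normrM mulrC (gtr0_norm k0).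
Qed.

Lemma continuous_dist_int : continuous (@dist_int R).
Proof.
move=> r; apply/cvgrPdist_lt => e e0; near=> s.
by apply: le_lt_trans (dist_intB_le _ _) _; near: s; exact: cvgr_dist_lt.
Unshelve. all: by end_near. Qed.

End DistInt.

Section CircleFun.
Context {R : realType}.
Implicit Types (g : R -> R).

(** For a [g] of period 1 this is the induced function on the circle; otherwise it depends on the
    lifts picked by [repr]. *)
Definition circle_fun g (x : circle R) : R := g (repr x).

Lemma periodic1_int g (x : R) (n : int) : (forall y, g (y + 1) = g y) ->
  g (x + n%:~R) = g x.
Proof.
move=> gp; case: n => n; first exact: periodic1_nat.
by rewrite NegzE mulrNz -[LHS](periodic1_nat _ n.+1 gp) subrK.
Qed.

Lemma circle_fun_pi g (x : R) : (forall y, g (y + 1) = g y) ->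
  circle_fun g (\pi_(circle R)%qT x) = g x.
Proof.
move=> gp; rewrite /circle_fun.
have : repr (\pi_(circle R)%qT x) - x \is a Num.int.
  by apply/circle_eqP; rewrite reprK.
by move=> /intrP[n h]; rewrite -[repr _](subrK x) h addrC periodic1_int.
Qed.

(** Nearby points of the circle have nearby lifts after an integer translation, which [g] does not
    see. *)
Lemma continuous_circle_fun g : continuous g -> (forall y, g (y + 1) = g y) ->
  continuous (circle_fun g).
Proof.
move=> cg gp x U /cg /nbhs_ballP[d /= d0 dP].
apply/nbhs_ballP; exists d => //= y; rewrite ballEmdist/= => /dist_int_lt[n xyn].
rewrite /circle_fun -(periodic1_int (repr y) n gp); apply: dP.
by rewrite /ball/= opprD addrA.
Qed.

Lemma measurable_circle (F : circle R -> R) : continuous F ->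
  measurable_fun [set: circle R] F.
Proof.
move=> /continuousP cF.
apply: (measurability _ (RGenOpens.measurableE R)).
move=> _ [_ [a [b ->] <-]]; rewrite setTI.
by apply: sub_sigma_algebra; apply: cF; exact: interval_open.
Qed.

Lemma measurable_circle_fun_ge g (c : R) : continuous g ->
  (forall y, g (y + 1) = g y) -> measurable [set x | (c <= circle_fun g x)%R].
Proof.
move=> cg gp; have mg := measurable_circle (continuous_circle_fun cg gp).
rewrite (_ : [set x | _] = setT `&` circle_fun g @^-1` `[c, +oo[).
  by apply: mg.
by rewrite setTI; apply/seteqP; split => x /=; rewrite in_itv/= andbT.
Qed.

End CircleFun.

(** * Bounds on the Riesz measure through its approximating densities *)

Section RieszMeasure.
Context {R : realType} (a : R) (q : nat).
Variable mu : {finite_measure set (circle R) -> \bar R}.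
Hypothesis mu_riesz : is_riesz_product a q mu.
Hypothesis a1 : -1 <= a <= 1.
Local Notation leb := (@lebesgue_measure R).

Lemma onePacos_ge0 (c : R) : 0 <= 1 + a * cos c.
Proof.
move: a1; rewrite -ler_norml => a1'; have := cos_max c => c1.
have : `|a * cos c| <= 1 by rewrite normrM mulr_ile1.
by rewrite ler_norml => /andP[? _]; lra.
Qed.

Lemma riesz_density_ge0 n x : 0 <= riesz_density a q n x.
Proof. by apply: prodr_ge0 => k _; exact: onePacos_ge0. Qed.

Lemma continuous_cos_mul (c : R) : continuous (fun x : R => cos (c * x)).
Proof.
apply: (@continuous_compR _ (fun x => c * x) (@cos R)); last exact: continuous_cos.
by move=> x; apply: cvgM; [exact: cvg_cst|exact: cvg_id].
Qed.

Lemma continuous_onePacos (c : R) : continuous (fun x : R => 1 + a * cos (c * x)).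
Proof.
move=> x; apply: cvgD; first exact: cvg_cst.
by apply: cvgM; [exact: cvg_cst|exact: continuous_cos_mul].
Qed.

Lemma continuous_riesz_density n : continuous (riesz_density a q n).
Proof.
apply: continuous_big; first exact: mul_continuous.
by move=> k _; exact: continuous_onePacos.
Qed.

(** Markov's inequality passed through the weak limit. The test function [Num.min (g y) 1] equals 1
    on the set, is dominated by [g], and is visibly integrable for [mu]. A bound for large [n] is
    enough for the limit. *)
Lemma riesz_measure_le (g : R -> R) (c : R) (m : nat) :
  continuous g -> (forall y, g (y + 1) = g y) -> (forall y, 0 <= g y) ->
  (forall n, (m <= n)%N ->
    \int[leb]_(x in `[0, 1]) (g x * riesz_density a q n x) <= c) ->
  (mu [set x | (1 <= circle_fun g x)%R] <= c%:E)%E.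
Proof.
move=> cg gp g0 gc; pose h y := Num.min (g y) 1.
have ch : continuous h.
  move=> y; have -> : h = (fun y => (g y + 1 - `|g y - 1|) / 2).
    by apply/funext => z; rewrite /h minr_absE.
  apply: cvgM; last exact: cvg_cst.
  apply: cvgB; first by apply: cvgD; [exact: cg|exact: cvg_cst].
  apply: (@continuous_compR _ (fun y => g y - 1) (fun y => `|y|)).
    by move=> z; apply: cvgB; [exact: cg|exact: cvg_cst].
  exact: norm_continuous.
have hp y : h (y + 1) = h y by rewrite /h gp.
have h0 y : 0 <= h y by rewrite le_min g0 ler01.
have h1 y : h y <= 1 by rewrite ge_min lexx orbT.
have cH := continuous_circle_fun ch hp.
have mH := measurable_circle cH.
have mA := measurable_circle_fun_ge 1 cg gp.
have iH : mu.-integrable setT (EFin \o circle_fun h).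
  apply: (@le_integrable _ _ _ mu setT measurableT _ (EFin \o cst 1)).
  - exact/measurable_EFinP.
  - by move=> x _; rewrite lee_fin normr1 ger0_norm// /circle_fun.
  - exact: finite_measure_integrable_cst.
have lim := mu_riesz cH.
have Hc : \int[mu]_(x in [set: circle R]) circle_fun h x <= c.
  apply: (cvgr_to_le lim); near=> n.
  apply: le_trans (_ : \int[leb]_(x in `[0, 1]) (g x * riesz_density a q n x) <=
    c); last first.
    by apply: gc; near: n; exact: nbhs_infty_ge.
  have cr := @continuous_riesz_density n.
  apply: le_Rintegral => //.
  - apply: continuous_integrable01 => x; apply: cvgM; last exact: cr.
    by rewrite /continuous_at; under eq_fun do rewrite circle_fun_pi//;
      rewrite circle_fun_pi//; exact: ch.
  - by apply: continuous_integrable01 => x; apply: cvgM; [exact: cg|exact: cr].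
  - move=> x _; rewrite circle_fun_pi//; apply: ler_wpM2r;
    first exact: riesz_density_ge0.
    by rewrite ge_min lexx.
apply: le_trans (_ : (\int[mu]_(x in setT) (circle_fun h x)%:E <= _)%E); last first.
  by rewrite -[X in (X <= _)%E]fineK ?integrable_fin_num// lee_fin.
rewrite -[X in (X <= _)%E]mul1e -integral_cst//.
apply: le_trans (_ : (\int[mu]_(x in [set x | (1 <= circle_fun g x)%R]) (circle_fun
  h x)%:E <= _)%E).
  apply: ge0_le_integral => //.
  - by apply/measurable_EFinP; exact: measurable_funTS.
  - by move=> x /= gx; rewrite lee_fin /circle_fun le_min gx lexx.
apply: ge0_subset_integral => //.
- exact/measurable_EFinP.
- by move=> x _; rewrite lee_fin h0.
Unshelve. all: by end_near. Qed.

End RieszMeasure.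
(** * Integrals against Riesz products *)

(** Both [x - cos x] and [x + cos x] are nondecreasing. *)
Lemma cos_lipschitz (R : realType) (u v : R) : `|cos u - cos v| <= `|u - v|.
Proof.
wlog uv : u v / u <= v.
  by move=> w; have [/w//|/ltW/w] := leP u v; rewrite distrC (distrC v).
rewrite (distrC u) [leRHS]ger0_norm ?subr_ge0// ler_norml; apply/andP; split.
  suff : u - cos u <= v - cos v by lra.
  apply: (@nondecr_of_derive _ (fun x => x - cos x) (fun x => 1 - - sin x)) => //.
  by move=> x; apply: cvgB; [exact: cvg_id|exact: continuous_cos].
suff : u + cos u <= v + cos v by lra.
apply: (@nondecr_of_derive _ (fun x => x + cos x) (fun x => 1 + - sin x)) => //.
by move=> x; apply: cvgD; [exact: cvg_id|exact: continuous_cos].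
Qed.

(** From [expR (- u) >= 1 - u], together with [(1 - u) * (1 + u + 2 u^2) = 1 + u^2 * (1 - 2 u) >=
    1]. *)
Lemma expR_le_quadratic (R : realType) (u : R) : u <= 1 / 2 ->
  expR u <= 1 + u + 2 * u ^+ 2.
Proof.
move=> u2; have h := expR_ge1Dx (- u); have p : 0 < 1 - u by lra.
have -> : expR u = (expR (- u))^-1 by rewrite expRN invrK.
apply: le_trans (_ : (1 - u)^-1 <= _).
  by rewrite lef_pV2 ?posrE ?expR_gt0.
rewrite -[leLHS]mul1r ler_pdivrMr//; nra.
Qed.

Section FoldMean.
Context {R : realType}.
Implicit Types (h g : R -> R) (N : nat).

Lemma ler_fold_mean N h g y : (forall x, h x <= g x) ->
  fold_mean N h y <= fold_mean N g y.
Proof.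
by move=> hg; rewrite ler_wpM2r ?invr_ge0//; apply: ler_sum.
Qed.

Lemma fold_meanD N h g y :
  fold_mean N (fun x => h x + g x) y = fold_mean N h y + fold_mean N g y.
Proof. by rewrite /fold_mean big_split mulrDl. Qed.

Lemma fold_meanZ N c h y : fold_mean N (fun x => c * h x) y = c * fold_mean N h y.
Proof. by rewrite /fold_mean -mulr_sumr mulrA. Qed.

Lemma fold_mean_cst N (c y : R) : (0 < N)%N -> fold_mean N (fun=> c) y = c.
Proof.
move=> N0; rewrite /fold_mean sumr_const card_ord -[c *+ N]mulr_natr mulfK//.
by rewrite pnatr_eq0 -lt0n.
Qed.

Lemma fold_mean_cos2pi N (u : R -> R) y : (0 < N)%N ->
  fold_mean N (fun x => u (2 * pi * x)) y = rot_sum N u (2 * pi * y / N%:R) / N%:R.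
Proof.
move=> N0; congr (_ / _); apply: eq_bigr => j _; congr u.
have : N%:R != 0 :> R by rewrite pnatr_eq0 -lt0n.
by move=> ?; field.
Qed.

(** A continuous periodic majorant of the indicator of the arc of radius [1 / N] around [x0],
    bounded by 2 and vanishing beyond distance [2 / N]. *)
Definition tent N (x0 x : R) : R := Num.max 0 (2 - N%:R * dist_int (x - x0)).

Lemma continuous_tent N (x0 : R) : continuous (tent N x0).
Proof.
have -> : tent N x0 = (fun y => (2 - N%:R * dist_int (y - x0) +
    `|2 - N%:R * dist_int (y - x0)|) / 2).
  by apply/funext => z; rewrite /tent maxr_absE sub0r normrN add0r.
have cc : continuous (fun y : R => 2 - N%:R * dist_int (y - x0)).
  move=> y; apply: cvgB; first exact: cvg_cst.
  apply: cvgM; first exact: cvg_cst.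
  apply: (@continuous_compR _ (fun y => y - x0) (@dist_int R));
    last exact: continuous_dist_int.
  by move=> z; apply: cvgB; [exact: cvg_id|exact: cvg_cst].
move=> y; apply: cvgM; last exact: cvg_cst.
apply: cvgD; first exact: cc.
by apply: (@continuous_compR _ _ (fun y => `|y|) cc); exact: norm_continuous.
Qed.

Lemma tentD1 N (x0 y : R) : tent N x0 (y + 1) = tent N x0 y.
Proof. by rewrite /tent (addrAC y 1) dist_intD1. Qed.

Lemma tent_ge0 N (x0 y : R) : 0 <= tent N x0 y.
Proof. by rewrite le_max lexx. Qed.

(* The nonzero terms are among the [j] congruent modulo [N] to one of the four
   integers closest to [N * x0 - y]. *)
Lemma fold_mean_tent N (x0 y : R) : (0 < N)%N ->
  fold_mean N (tent N x0) y <= 8 / N%:R.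
Proof.
move=> N0; have Np : 0 < N%:R :> R by rewrite ltr0n.
rewrite /fold_mean ler_pM2r ?invr_gt0//.
pose w := Num.floor (N%:R * x0 - y).
pose v (l : 'I_4) : int := ((w - 1 + l%:Z) %% N%:Z)%Z.
have hj (j : 'I_N) : tent N x0 ((y + j%:R) / N%:R) <=
    \sum_(l < 4) (if j%:Z == v l then 2 else 0 : R).
  have [d2|d2] := leP 2 (N%:R * dist_int ((y + j%:R) / N%:R - x0)).
    rewrite /tent max_l ?subr_le0//; apply: sumr_ge0 => l _.
    by case: ifP.
  rewrite mulrC -ltr_pdivlMr// in d2; have [n hn] := dist_int_lt d2.
  rewrite ltr_pdivlMr// mulrC -{1}(gtr0_norm Np) -normrM in hn.
  pose z := N%:R * x0 - y.
  have hz : `|j%:R - z - N%:R * n%:~R| < 2.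
    by move: hn; congr (`|_| < _); rewrite /z; field; rewrite lt0r_neq0.
  have /andP[w1 w2] : w%:~R <= z < (w + 1)%:~R by exact: floor_itv.
  rewrite intrD in w2.
  pose i : int := j%:Z - N%:Z * n.
  have iE : i%:~R = j%:R - N%:R * n%:~R :> R by rewrite intrB intrM -!pmulrn.
  move: hz; rewrite ltr_norml addrAC -iE => /andP[i1 i2].
  have wi : w - 1 <= i.
    have : (w - 2)%:~R < i%:~R :> R by rewrite intrB; lra.
    by rewrite ltr_int => ?; lia.
  have iw : i < w + 3.
    have : i%:~R < (w + 3)%:~R :> R by rewrite intrD; lra.
    by rewrite ltr_int.
  have [l lE] : exists l : 'I_4, i = w - 1 + l%:Z.
    have l4 : (absz (i - (w - 1))%R < 4)%N by lia.
    by exists (Ordinal l4) => /=; lia.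
  have jE : j%:Z = v l.
    rewrite /v -lE /i -mulrN [N%:Z * _]mulrC addrC modzMDl modz_small//.
    by rewrite ltz_nat ltn_ord.
  rewrite (bigD1 l)//= jE eqxx; apply: le_trans (_ : 2 <= _).
    by rewrite /tent ge_max ler0n gerBl mulr_ge0 ?dist_int_ge0.
  by rewrite lerDl; apply: sumr_ge0 => k _; case: ifP.
apply: le_trans (ler_sum _ (fun j _ => hj j)) _.
(* For each of the four [l] at most one [j] below [N] equals [v l], and it contributes 2, whence the
   constant 8. *)
rewrite exchange_big/=; apply: le_trans (_ : \sum_(l < 4) 2 <= _); last first.
  by rewrite sumr_const card_ord -mulr_natl; lra.
apply: ler_sum => l _; rewrite -big_mkcond/=.
have [/existsP[j /eqP jE]|/existsPn h] := boolP [exists j : 'I_N, j%:Z == v l].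
  rewrite (big_pred1 j)// => k /=; rewrite -jE; apply/eqP/eqP => [[kj]|->//].
  exact: val_inj.
by rewrite big_pred0// => j; apply/negbTE/h.
Qed.

End FoldMean.

(** * Iterating the transfer operator *)

Section RieszEstimates.
Context {R : realType} (a : R) (q : nat).
Hypothesis a1 : -1 <= a <= 1.
Hypothesis q2 : (2 <= q)%N.
Local Notation leb := (@lebesgue_measure R).

Let q0 : (0 < q)%N. Proof. exact: ltnW. Qed.

Definition riesz_factor (x : R) : R := 1 + a * cos (2 * pi * x).
Definition orbit_prod (n : nat) (h : R -> R) (x : R) : R :=
  \prod_(k < n) h ((q ^ k)%:R * x).

Hypothesis mean_factor : forall y, fold_mean q riesz_factor y <= 1.

Lemma continuous_orbit_prod n h : continuous h -> continuous (orbit_prod n h).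
Proof.
move=> ch; apply: continuous_big; first exact: mul_continuous.
move=> k _; apply: (@continuous_compR _ (fun x => (q ^ k)%:R * x) h) => // x.
by apply: cvgM; [exact: cvg_cst|exact: cvg_id].
Qed.

Lemma periodic_orbit_prod n h x : (forall y, h (y + 1) = h y) ->
  orbit_prod n h (x + 1) = orbit_prod n h x.
Proof.
by move=> hp; apply: eq_bigr => k _; rewrite mulrDr mulr1 periodic1_nat.
Qed.

Lemma orbit_prodS n h x : orbit_prod n.+1 h x = h x * orbit_prod n h (q%:R * x).
Proof.
rewrite /orbit_prod big_ord_recl/= expn0 mul1r; congr (_ * _).
by apply: eq_bigr => k _; rewrite /bump/= add1n expnSr natrM mulrA.
Qed.

Lemma riesz_densityE n x : riesz_density a q n x = orbit_prod n.+1 riesz_factor x.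
Proof.
by rewrite /riesz_density big_mkord; apply: eq_bigr => k _; rewrite /riesz_factor mulrA.
Qed.

(** The density of index [n + m] has [n + m + 1] factors: [n] are split off and [m + 1] remain. *)
Lemma riesz_densityD n m x : riesz_density a q (n + m) x =
  orbit_prod n riesz_factor x * riesz_density a q m ((q ^ n)%:R * x).
Proof.
elim: n x => [|n IH] x.
  by rewrite /orbit_prod big_ord0 mul1r expn0 mul1r.
rewrite addSn riesz_densityE orbit_prodS -riesz_densityE IH orbit_prodS -mulrA.
by rewrite expnSr natrM -!mulrA.
Qed.

Lemma riesz_factor_ge0 x : 0 <= riesz_factor x.
Proof. exact: onePacos_ge0. Qed.

Lemma riesz_factorD1 x : riesz_factor (x + 1) = riesz_factor x.
Proof. by rewrite /riesz_factor mulrDr mulr1 mulr_natl cosD2pi. Qed.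

Lemma continuous_riesz_factor : continuous riesz_factor.
Proof. exact: continuous_onePacos. Qed.

Lemma riesz_densityD1 n x : riesz_density a q n (x + 1) = riesz_density a q n x.
Proof. by rewrite !riesz_densityE periodic_orbit_prod//; exact: riesz_factorD1. Qed.

Lemma orbit_prod_ge0 n h x : (forall y, 0 <= h y) -> 0 <= orbit_prod n h x.
Proof. by move=> h0; apply: prodr_ge0. Qed.

(** The factors other than the first form a function of [q x], so folding replaces the first factor
    by its mean, at most 1; induction does the rest. *)
Lemma Rintegral_riesz_density_le1 n :
  \int[leb]_(x in `[0, 1]) riesz_density a q n x <= 1.
Proof.
have cr := continuous_riesz_factor.
have I1 : \int[leb]_(x in `[0, 1]) (1 : R) = 1.
  by rewrite Rintegral_cst//= lebesgue_measure_itv/= lte_fin ltr01 -EFinB subr0 mulr1.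
elim: n => [|n IH].
  have c1 : continuous (fun _ : R => 1 : R) by apply: cst_continuous.
  have := @Rintegral_fold_le _ q riesz_factor (fun=> 1) 1 q0 cr c1
    (fun=> erefl) (fun=> ler01) mean_factor.
  rewrite I1 mulr1; apply: le_trans; rewrite le_eqVlt; apply/orP; left; apply/eqP.
  apply: eq_Rintegral => x _.
  by rewrite riesz_densityE /orbit_prod big_ord1 expn0 mul1r mulr1.
have := @Rintegral_fold_le _ q riesz_factor (riesz_density a q n) 1 q0 cr
  (@continuous_riesz_density _ _ _ n) (riesz_densityD1 n) (riesz_density_ge0 q a1
    n) mean_factor.
rewrite mul1r => h; apply: le_trans IH; apply: le_trans h.
rewrite le_eqVlt; apply/orP; left; apply/eqP; apply: eq_Rintegral => x _.
by rewrite riesz_densityE orbit_prodS -riesz_densityE.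
Qed.

(** Each of the [n] foldings costs a factor [M], and the remaining Riesz density has integral at
    most 1. *)
Lemma Rintegral_orbit_prod_le (h : R -> R) (M : R) n m : continuous h ->
  (forall y, h (y + 1) = h y) -> (forall y, 0 <= h y) ->
  (forall y, fold_mean q h y <= M) -> 0 <= M ->
  \int[leb]_(x in `[0, 1])
    (orbit_prod n h x * riesz_density a q m ((q ^ n)%:R * x)) <= M ^+ n.
Proof.
move=> ch hp h0 hM M0; elim: n => [|n IH].
  apply: le_trans (Rintegral_riesz_density_le1 m).
  rewrite le_eqVlt; apply/orP; left; apply/eqP; apply: eq_Rintegral => x _.
  by rewrite /orbit_prod big_ord0 mul1r expn0 mul1r.
pose G (x : R) := orbit_prod n h x * riesz_density a q m ((q ^ n)%:R * x).
have cG : continuous G.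
  move=> x; apply: cvgM; first exact: continuous_orbit_prod.
  apply: (@continuous_compR _ (fun x => (q ^ n)%:R * x) (riesz_density a q m)).
    by move=> {}x; apply: cvgM; [exact: cvg_cst|exact: cvg_id].
  exact: continuous_riesz_density.
have Gp y : G (y + 1) = G y.
  rewrite /G periodic_orbit_prod// mulrDr mulr1 periodic1_nat//.
  exact: riesz_densityD1.
have G0 y : 0 <= G y.
  by rewrite mulr_ge0 ?orbit_prod_ge0//; exact: riesz_density_ge0.
have := Rintegral_fold_le q0 ch cG Gp G0 hM.
rewrite exprS => hh; apply: le_trans (ler_wpM2l M0 IH); apply: le_trans hh.
rewrite le_eqVlt; apply/orP; left; apply/eqP; apply: eq_Rintegral => x _.
by rewrite /G orbit_prodS expnSr natrM !mulrA.
Qed.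

End RieszEstimates.
(** * Measure estimates *)

Section LogDensity.
Context {R : realType} (a : R).
Hypothesis a1 : -1 <= a <= 1.

(* The shift by [e] makes the logarithm bounded and Lipschitz even when the
   factor vanishes, which happens for [a = 1] and [a = -1]. *)
Definition log_factor (e x : R) : R := ln (e + riesz_factor a x).

Definition birkhoff_sum (q n : nat) (f : R -> R) (x : R) : R :=
  \sum_(k < n) f ((q ^ k)%:R * x).

Variable e : R.
Hypothesis e0 : 0 < e.

Let pos x : 0 < e + riesz_factor a x.
Proof. by rewrite ltr_wpDr// riesz_factor_ge0. Qed.

Lemma continuous_log_factor : continuous (log_factor e).
Proof.
move=> x.
apply: (continuous_comp (f := fun x => e + riesz_factor a x) (g := @ln R)).
  by apply: cvgD; [exact: cvg_cst|exact: continuous_riesz_factor].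
exact: continuous_ln.
Qed.

Lemma log_factorD1 x : log_factor e (x + 1) = log_factor e x.
Proof. by rewrite /log_factor riesz_factorD1. Qed.

Lemma riesz_factor_le2 x : riesz_factor a x <= 2.
Proof.
have : `|a * cos (2 * pi * x)| <= 1.
  by rewrite normrM mulr_ile1// ?cos_max// ler_norml.
by rewrite ler_norml /riesz_factor => /andP[_ ?]; lra.
Qed.

(** The argument of the logarithm lies between [e] and 3; [ln y < y] is applied to it and to its
    inverse. *)
Lemma log_factor_bounded x : e <= 1 -> `|log_factor e x| <= 3 + e^-1.
Proof.
move=> e1; have ei : 0 < e^-1 by rewrite invr_gt0.
have := pos x; have := riesz_factor_le2 x; have := riesz_factor_ge0 a1 x.
rewrite /log_factor; move: (riesz_factor a x) => r r0 r2 p.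
rewrite ler_norml; apply/andP; split.
  rewrite lerNl -lnV ?posrE//.
  apply: le_trans (ltW (ln_sublinear _)) _; first by rewrite invr_gt0.
  by apply: le_trans (_ : e^-1 <= _); [rewrite lef_pV2 ?posrE// lerDl|rewrite lerDr].
apply: le_trans (ltW (ln_sublinear p)) _; lra.
Qed.

Lemma riesz_factor_expR_le x : riesz_factor a x <= expR (log_factor e x).
Proof. by rewrite lnK ?posrE// lerDr ltW. Qed.

(** The regularization costs at most [e], since [r * ln (1 + e / r) <= e] for [r > 0]. *)
Lemma mul_log_factor_le x : riesz_factor a x * log_factor e x <=
  riesz_factor a x * ln (riesz_factor a x) + e.
Proof.
rewrite /log_factor; have := pos x; have := riesz_factor_ge0 a1 x.
move: (riesz_factor a x) => r; rewrite le_eqVlt => /predU1P[<-|r0] p.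
  by rewrite !mul0r add0r ltW.
have -> : e + r = r * (1 + e / r) by field; rewrite lt0r_neq0.
have h : 0 < 1 + e / r by rewrite addr_gt0// divr_gt0.
rewrite lnM ?posrE// mulrDr lerD2l.
apply: le_trans (_ : r * (e / r) <= _); last by rewrite mulrCA mulfV ?mulr1// lt0r_neq0.
by rewrite ler_pM2l// le_ln1Dx// (lt_trans _ (divr_gt0 e0 r0)).
Qed.

(** The factor has Lipschitz constant at most [2 * pi], and the logarithm is taken at arguments no
    smaller than [e]. *)
Lemma log_factor_lipschitz s t :
  log_factor e s <= log_factor e t + 2 * pi / e * dist_int (s - t).
Proof.
have C0 : 0 < 2 * pi / e :> R by rewrite divr_gt0// mulr_gt0// pi_gt0.
rewrite -lerBlDl mulrC -ler_pdivrMr//; apply: dist_int_ge => n.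
rewrite ler_pdivrMr// mulrC lerBlDl.
rewrite -(periodic1_int t n log_factorD1).
set u := t + n%:~R; have -> : s - t - n%:~R = s - u by rewrite /u opprD addrA.
rewrite /log_factor -lerBlDl -ln_div ?posrE//.
have h : (e + riesz_factor a s) / (e + riesz_factor a u) =
    1 + (riesz_factor a s - riesz_factor a u) / (e + riesz_factor a u).
  by field; rewrite lt0r_neq0.
have rd : `|riesz_factor a s - riesz_factor a u| <= 2 * pi * `|s - u|.
  rewrite /riesz_factor opprD addrACA subrr add0r -mulrBr normrM.
  apply: le_trans (_ : 1 * `|cos (2 * pi * s) - cos (2 * pi * u)| <= _).
    by apply: ler_wpM2r => //; rewrite ler_norml.
  rewrite mul1r; apply: le_trans (cos_lipschitz _ _) _.
  by rewrite -mulrBr normrM gtr0_norm// mulr_gt0// pi_gt0.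
rewrite h; apply: le_trans (le_ln1Dx _) _.
  have := divr_gt0 (pos s) (pos u); rewrite h; move: (_ / _) => X X0; lra.
apply: le_trans (ler_norm _) _; rewrite normrM normfV [X in _ / X]gtr0_norm//.
apply: (@le_trans _ _ (2 * pi * `|s - u| / e)); last by rewrite mulrAC.
apply: ler_pM => //; first by rewrite invr_ge0 ltW.
by rewrite lef_pV2 ?posrE// lerDl riesz_factor_ge0.
Qed.

Lemma continuous_birkhoff_sum q n f : continuous f -> continuous (birkhoff_sum q n f).
Proof.
move=> cf; apply: continuous_big; first exact: add_continuous.
move=> k _; apply: (@continuous_compR _ (fun x => (q ^ k)%:R * x) f) => // x.
by apply: cvgM; [exact: cvg_cst|exact: cvg_id].
Qed.

Lemma birkhoff_sumD1 q n f x : (forall y, f (y + 1) = f y) ->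
  birkhoff_sum q n f (x + 1) = birkhoff_sum q n f x.
Proof.
by move=> fp; apply: eq_bigr => k _; rewrite mulrDr mulr1 periodic1_nat.
Qed.

(** Bounded distortion: the distance of the orbits at time [k] is at most [2 q^k / q^n], and these
    sum to at most 2, uniformly in [n]. *)
Lemma birkhoff_log_factor_le q n s t : (2 <= q)%N ->
  dist_int (s - t) <= 2 / (q ^ n)%:R ->
  birkhoff_sum q n (log_factor e) s <= birkhoff_sum q n (log_factor e) t + 4 * pi / e.
Proof.
move=> q2 st; have C0 : 0 < 2 * pi / e :> R by rewrite divr_gt0// mulr_gt0// pi_gt0.
have qn : 0 < (q ^ n)%:R :> R by rewrite ltr0n expn_gt0 ltnW.
apply: (@le_trans _ _ (\sum_(k < n) (log_factor e ((q ^ k)%:R * t) +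
    2 * pi / e * (2 / (q ^ n)%:R) * (q ^ k)%:R))).
  apply: ler_sum => k _; apply: le_trans (log_factor_lipschitz _ ((q ^ k)%:R * t)) _.
  rewrite lerD2l -[leRHS]mulrA ler_pM2l// -mulrBr.
  apply: le_trans (dist_int_mulrn _ _) _.
  by rewrite mulrC ler_wpM2r.
rewrite big_split/= lerD2l -mulr_sumr.
have hs : \sum_(k < n) (q ^ k)%:R <= (q ^ n)%:R :> R.
  rewrite -natr_sum ler_nat; elim: n {st qn} => [|n IH]; first by rewrite big_ord0.
  rewrite big_ord_recr/= expnS; apply: leq_trans (_ : q ^ n + q ^ n <= _)%N.
    by rewrite leq_add2r.
  by rewrite addnn -mul2n leq_pmul2r ?expn_gt0 ?(ltnW q2).
apply: le_trans (ler_wpM2l _ hs) _;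
  first by rewrite mulr_ge0 ?divr_ge0 ?mulr_ge0 ?pi_ge0 ?ltW.
by rewrite le_eqVlt; apply/orP; left; apply/eqP; field; rewrite !lt0r_neq0.
Qed.

End LogDensity.

(** * Large deviations of Birkhoff sums and masses of small arcs *)

Section MeasureEstimates.
Context {R : realType} (a : R) (q : nat).
Variable mu : {finite_measure set (circle R) -> \bar R}.
Hypothesis mu_riesz : is_riesz_product a q mu.
Hypothesis a1 : -1 <= a <= 1.
Hypothesis q2 : (2 <= q)%N.
Hypothesis mean_factor : forall y, fold_mean q (riesz_factor a) y <= 1.
Local Notation leb := (@lebesgue_measure R).

Let q0 : (0 < q)%N. Proof. exact: ltnW. Qed.

(* The transfer operator [fold_mean q] contracts the exponential moments of the
   Birkhoff sums at a geometric rate, whence a Chernoff bound. *)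
Lemma birkhoff_deviation (B e : R) :
  (forall y, fold_mean q (fun x => riesz_factor a x * ln (riesz_factor a x)) y <= B) ->
  0 < e -> e <= 1 ->
  exists2 rho : R, 0 < rho < 1 & forall n,
    (mu [set x | (n%:R * (B + 3 * e) <=
         circle_fun (birkhoff_sum q n (log_factor a e)) x)%R] <= (rho ^+ n)%:E)%E.
Proof.
move=> hB e0 e1; pose K := 3 + e^-1.
have K3 : 3 <= K by rewrite lerDl invr_ge0 ltW.
have K0 : 0 < K by lra.
(* Small enough that [lam * |f| <= 1 / 2], as [expR_le_quadratic] requires, and that the quadratic
   term [2 * (lam * f) ^+ 2] is at most [lam * e]. *)
pose lam := e / (2 * K ^+ 2).
have lam0 : 0 < lam by rewrite divr_gt0// mulr_gt0// exprn_gt0.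
have lamK : lam * K <= 1 / 2.
  have -> : lam * K = e / (2 * K) by rewrite /lam; field; rewrite lt0r_neq0.
  by rewrite ler_pdivrMr ?mulr_gt0//; lra.
have lamK2 : 2 * lam * K ^+ 2 = e by rewrite /lam; field; rewrite lt0r_neq0.
pose f := log_factor a e.
pose h x := expR (lam * f x) * riesz_factor a x.
have cf : continuous f by exact: continuous_log_factor.
have fp y : f (y + 1) = f y by exact: log_factorD1.
have ch : continuous h.
  move=> x; apply: cvgM; last exact: continuous_riesz_factor.
  apply: (@continuous_compR _ (fun x => lam * f x) expR); last exact: continuous_expR.
  by move=> {}x; apply: cvgM; [exact: cvg_cst|exact: cf].
have h0 y : 0 <= h y by rewrite mulr_ge0 ?expR_ge0 ?riesz_factor_ge0.
have hp y : h (y + 1) = h y by rewrite /h fp riesz_factorD1.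
(* One [e] pays for the quadratic term, the other for the regularization: the mean of [h] is at most
   [1 + lam * (B + 2 * e)]. *)
pose M := expR (lam * (B + 2 * e)).
have hM y : fold_mean q h y <= M.
  apply: (@le_trans _ _ (fold_mean q (fun x => (1 + lam * e) * riesz_factor a x +
      lam * (riesz_factor a x * ln (riesz_factor a x) + e)) y)).
    apply: ler_fold_mean => x; rewrite /h.
    have r0 := riesz_factor_ge0 a1 x.
    have fK := log_factor_bounded a1 e0 x e1.
    rewrite -/K -/f in fK.
    have u2 : lam * f x <= 1 / 2.
      apply: le_trans lamK; rewrite ler_pM2l//.
      by apply: le_trans fK; exact: ler_norm.
    apply: le_trans (ler_wpM2r r0 (expR_le_quadratic u2)) _.
    have f2 : f x ^+ 2 <= K ^+ 2 by rewrite -real_normK ?num_real//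
      ler_pXn2r ?nnegrE// ltW.
    have lf2 : 2 * (lam * f x) ^+ 2 <= lam * e.
      rewrite exprMn -lamK2; have : lam ^+ 2 * f x ^+ 2 <= lam ^+ 2 * K ^+ 2.
        by rewrite ler_pM2l// exprn_gt0.
      by rewrite expr2; lra.
    have := ler_wpM2l (ltW lam0) (mul_log_factor_le a1 e0 x); rewrite -/f => hf.
    have := ler_wpM2r r0 lf2; lra.
  rewrite (fold_meanD q (fun x => (1 + lam * e) * riesz_factor a x)) !fold_meanZ.
  rewrite (fold_meanD q (fun x => riesz_factor a x * ln (riesz_factor a x)))
    fold_mean_cst//.
  apply: (@le_trans _ _ ((1 + lam * e) * 1 + lam * (B + e))).
    apply: lerD; first by apply: ler_wpM2l => //; rewrite addr_ge0// mulr_ge0// ltW.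
    by rewrite ler_pM2l// lerD2r.
  by apply: le_trans (expR_ge1Dx _); lra.
(* The gap between the threshold [B + 3 * e] and the exponent [B + 2 * e] of [M]. *)
exists (expR (- (lam * e))).
  rewrite expR_gt0/= -[ltRHS]expR0 ltr_expR oppr_lt0 mulr_gt0//.
move=> n.
pose g x := expR (lam * (birkhoff_sum q n f x - n%:R * (B + 3 * e))).
have cS : continuous (birkhoff_sum q n f) by exact: continuous_birkhoff_sum.
have cg : continuous g.
  apply: (@continuous_compR _ (fun x => lam * (birkhoff_sum q n f x - n%:R * (B + 3
    * e))) expR); last exact: continuous_expR.
  move=> x; apply: cvgM; first exact: cvg_cst.
  by apply: cvgB; [exact: cS|exact: cvg_cst].
have gp y : g (y + 1) = g y by rewrite /g birkhoff_sumD1.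
have -> : [set x | (n%:R * (B + 3 * e) <= circle_fun (birkhoff_sum q n f) x)%R] =
    [set x | (1 <= circle_fun g x)%R].
  apply/seteqP; split => x /=;
    rewrite /circle_fun /g -[1]expR0 ler_expR pmulr_rge0// subr_ge0//.
apply: (riesz_measure_le (m := n) mu_riesz a1 cg gp).
  by move=> y; exact: expR_ge0.
move=> n' /subnKC <-; set m := (n' - n)%N.
(* The exponential weight is distributed over the first [n] factors, turning each [riesz_factor]
   into [h]. *)
have gE x : g x * riesz_density a q (n + m) x =
    expR (- (lam * (n%:R * (B + 3 * e)))) * (orbit_prod q n h x * riesz_density a q
      m ((q ^ n)%:R * x)).
  have <- : expR (lam * birkhoff_sum q n f x) * orbit_prod q n (riesz_factor a) x =
      orbit_prod q n h x.
    by rewrite /birkhoff_sum mulr_sumr expR_sum -big_split.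
  by rewrite riesz_densityD /g mulrBr expRD; ring.
under eq_Rintegral do rewrite gE.
have cO : continuous (fun x => orbit_prod q n h x * riesz_density a q m ((q ^ n)%:R
  * x)).
  move=> x; apply: cvgM; first exact: continuous_orbit_prod.
  apply: (@continuous_compR _ (fun x => (q ^ n)%:R * x) (riesz_density a q m)).
    by move=> {}x; apply: cvgM; [exact: cvg_cst|exact: cvg_id].
  exact: continuous_riesz_density.
rewrite RintegralZl//; last exact: continuous_integrable01.
have := Rintegral_orbit_prod_le a1 q2 mean_factor n m ch hp h0 hM (expR_ge0 _).
rewrite -(ler_pM2l (expR_gt0 (- (lam * (n%:R * (B + 3 * e)))))) => hh;
  apply: le_trans hh _.
by rewrite /M -!expRM_natl -expRD ler_expR; lra.
Qed.

(** On the support of the tent, bounded distortion replaces the first [n] factors by the exponential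
    of the Birkhoff sum at [x0]. Folding by [q ^ n] then bounds the tent by [8 / q ^ n], and the
    remaining factors have integral at most 1. *)
Lemma measure_ball_le (e x0 : R) (n : nat) : 0 < e ->
  (mu [set y | (1 <= circle_fun (tent (q ^ n) x0) y)%R]
   <= (8 * expR (4 * pi / e) / (q ^ n)%:R * expR (birkhoff_sum q n (log_factor a e)
     x0))%:E)%E.
Proof.
move=> e0; have N0 : (0 < q ^ n)%N by rewrite expn_gt0 q0.
have Np : 0 < (q ^ n)%:R :> R by rewrite ltr0n.
pose phi := tent (q ^ n) x0; have cphi : continuous phi := @continuous_tent _ _ _.
have phi0 y : 0 <= phi y := tent_ge0 _ _ _.
apply: (riesz_measure_le (m := n) mu_riesz a1 cphi (tentD1 _ _) phi0).
move=> n' /subnKC <-; set m := (n' - n)%N.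
pose c := expR (birkhoff_sum q n (log_factor a e) x0 + 4 * pi / e).
have cr : continuous (fun x : R => riesz_density a q m ((q ^ n)%:R * x)).
  apply: (@continuous_compR _ (fun x => (q ^ n)%:R * x) (riesz_density a q m)).
    by move=> x; apply: cvgM; [exact: cvg_cst|exact: cvg_id].
  exact: continuous_riesz_density.
apply: (@le_trans _ _ (\int[leb]_(x in `[0, 1]) (c * (phi x * riesz_density a q m
  ((q ^ n)%:R * x))))).
  apply: le_Rintegral => //.
  - apply: continuous_integrable01 => x; apply: cvgM; first exact: cphi.
    exact: continuous_riesz_density.
  - apply: continuous_integrable01 => x; apply: cvgM; first exact: cvg_cst.
    by apply: cvgM; [exact: cphi|exact: cr].
  - move=> x _; rewrite riesz_densityD mulrA mulrA.
    apply: ler_wpM2r; first exact: riesz_density_ge0.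
    rewrite mulrC; have [d2|d2] := leP 2 ((q ^ n)%:R * dist_int (x - x0)).
      by rewrite /phi /tent max_l ?subr_le0// !mulr0.
    apply: ler_wpM2r => //.
    apply: (@le_trans _ _ (expR (birkhoff_sum q n (log_factor a e) x))).
      rewrite /birkhoff_sum expR_sum; apply: ler_prod => k _.
      by rewrite riesz_factor_ge0//= riesz_factor_expR_le.
    rewrite ler_expR; apply: birkhoff_log_factor_le => //.
    by rewrite ler_pdivlMr// mulrC ltW.
rewrite RintegralZl//; last first.
  by apply: continuous_integrable01 => x; apply: cvgM; [exact: cphi|exact: cr].
have := @Rintegral_fold_le _ _ phi (riesz_density a q m) (8 / (q ^ n)%:R) N0 cphi
  (@continuous_riesz_density _ _ _ m) (riesz_densityD1 _ _ _) (riesz_density_ge0 q a1 m)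
  (fun y => fold_mean_tent x0 y N0).
move=> h; have c0 : 0 <= c by exact: expR_ge0.
apply: le_trans (ler_wpM2l c0 h) _.
have h1 := Rintegral_riesz_density_le1 a1 q2 mean_factor m.
apply: le_trans (_ : c * (8 / (q ^ n)%:R * 1) <= _).
  by apply: ler_wpM2l => //; apply: ler_wpM2l => //; rewrite divr_ge0.
by rewrite /c expRD le_eqVlt; apply/orP; left; apply/eqP; field; rewrite lt0r_neq0.
Qed.

End MeasureEstimates.
(** * The mass distribution principle *)

(* [n] is essentially the scale of [d], unless [d = 0], when it is just large. *)
Lemma scale_exists (R : realType) (Q s c d err : R) (N0 : nat) :
  2 <= Q -> 0 <= s -> 0 < c -> 0 <= d -> d * Q ^+ N0 <= 1 -> 0 < err ->
  exists2 n, (N0 <= n)%N & d * Q ^+ n <= 1 /\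
    expR (- (n%:R * (s * ln Q + c))) <= expR (s * ln Q) * d `^ s + err.
Proof.
move=> Q2 s0 c0 d0 dN err0.
have Q0 : 0 < Q by lra.
have lQ : 0 < ln Q by rewrite ln_gt0; lra.
move: d0; rewrite le_eqVlt => /predU1P[d0|d0].
  rewrite -d0; set c' := s * ln Q + c.
  have c'0 : 0 < c' by rewrite ltr_wpDl// mulr_ge0// ltW.
  (* By [1 + y <= expR y] it suffices that [n * c'] be at least [1 / err]. *)
  pose n := maxn N0 (Num.trunc ((err * c')^-1)).+1.
  exists n; first exact: leq_maxl.
  split; first by rewrite mul0r.
  apply: (@le_trans _ _ err); last by rewrite lerDr mulr_ge0 ?expR_ge0 ?powR_ge0.
  have h : (err * c')^-1 <= n%:R.
    have p : 0 < (err * c')^-1 by rewrite invr_gt0 mulr_gt0.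
    have /andP[_ /ltW h] := truncn_itv (ltW p).
    by apply: le_trans h _; rewrite ler_nat leq_maxr.
  have nc : err^-1 <= n%:R * c'.
    by rewrite -ler_pdivrMr// -invfM.
  have ei : 0 < err^-1 by rewrite invr_gt0.
  rewrite expRN -[err]invrK lef_pV2 ?posrE ?expR_gt0//.
  by apply: le_trans nc _; apply: le_trans (expR_ge1Dx _); lra.
(* For [d > 0] the largest such [n] is taken; its maximality gives [Q ^- n < Q * d]. *)
have exP : exists n, d * Q ^+ n <= 1 by exists N0.
have ubP n : d * Q ^+ n <= 1 -> (n <= Num.trunc (d^-1))%N.
  move=> dn; have di : 0 < d^-1 by rewrite invr_gt0.
  have /andP[_ h] := truncn_itv (ltW di).
  rewrite -ltnS -(ltr_nat R); apply: le_lt_trans h.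
  rewrite -[leRHS]mul1r ler_pdivlMr//; apply: le_trans dn.
  rewrite mulrC ler_pM2l//.
  have : (n%:R : R) <= 2 ^+ n by rewrite -natrX ler_nat ltnW// ltn_expl.
  by move=> /le_trans; apply; rewrite lerXn2r ?nnegrE//; lra.
case: (ex_maxnP exP ubP) => n dn nmax; exists n; first exact: nmax.
split => //.
have : 1 < d * Q ^+ n.+1.
  by rewrite ltNge; apply/negP => /nmax; rewrite ltnn.
move=> /ln_gt0; rewrite lnM ?posrE ?exprn_gt0// lnXn// => h.
apply: (@le_trans _ _ (expR (s * ln Q) * d `^ s)); last by rewrite lerDl ltW.
rewrite /powR gt_eqF// -expRD ler_expR.
rewrite -(mulr_natl (ln Q)) -natr1 in h.
have := ler_wpM2l s0 (ltW h).
by have : 0 <= n%:R * c; [rewrite mulr_ge0// ltW|nra].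
Qed.

Section LowerDimension.
Context {R : realType} (a : R) (q : nat).
Variable mu : {finite_measure set (circle R) -> \bar R}.
Hypothesis mu_riesz : is_riesz_product a q mu.
Hypothesis a1 : -1 <= a <= 1.
Hypothesis q2 : (2 <= q)%N.
Hypothesis mean_factor : forall y, fold_mean q (riesz_factor a) y <= 1.
Variable B : R.
Hypothesis hB : forall y,
  fold_mean q (fun x => riesz_factor a x * ln (riesz_factor a x)) y <= B.

Let Q2 : 2 <= q%:R :> R. Proof. by rewrite ler_nat. Qed.
Let lQ : 0 < ln q%:R :> R. Proof. by apply: ln_gt0; rewrite ltr1n. Qed.
Let Qp : 0 < q%:R :> R. Proof. by rewrite ltr0n ltnW. Qed.

(** In a fine cover of [F], each set either lies in an exceptional set [E n], of exponentially small
    mass, or meets its complement and then lies in an arc of controlled mass. *)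
Lemma measure_eq0_of_hausdorff (s : R) (F : set (circle R)) :
  0 <= s -> s < 1 - B / ln q%:R -> measurable F -> hausdorff_measure s F = 0%E ->
  mu F = 0%E.
Proof.
move=> s0 sB mF HF.
have gap : 0 < (1 - s) * ln q%:R - B.
  by move: sB; rewrite ltrBrDl addrC -ltrBrDl ltr_pdivrMr// => ?; rewrite subr_gt0.
(* Of the [4 * e] available, three are used by the deviation estimate and the last becomes the rate
   [c] of [scale_exists]. *)
pose e := Num.min 1 (((1 - s) * ln q%:R - B) / 4).
have e0 : 0 < e by rewrite lt_min ltr01 divr_gt0.
have e1 : e <= 1 by rewrite ge_min lexx.
have e4 : B + 4 * e <= (1 - s) * ln q%:R.
  have : e <= ((1 - s) * ln q%:R - B) / 4 by rewrite ge_min lexx orbT.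
  lra.
have [rho /andP[rho0 rho1] hrho] := birkhoff_deviation mu_riesz a1 q2 mean_factor
  hB e0 e1.
pose f := log_factor a e.
pose E n := [set x | (n%:R * (B + 3 * e) <= circle_fun (birkhoff_sum q n f) x)%R].
have mE n : measurable (E n).
  apply: measurable_circle_fun_ge.
    by apply: continuous_birkhoff_sum; exact: continuous_log_factor.
  by move=> y; apply: birkhoff_sumD1 => z; exact: log_factorD1.
pose C := 8 * expR (4 * pi / e).
have C0 : 0 < C by rewrite mulr_gt0// expR_gt0.
pose D := expR (s * ln q%:R).
have D0 : 0 < D by exact: expR_gt0.
suff key err : 0 < err -> (mu F <= ((C * D + C + 1) * err)%:E)%E.
  apply/eqP; rewrite eq_le measure_ge0 andbT.
  apply/lee_addgt0Pr => t t0; rewrite add0e.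
  have K0 : 0 < C * D + C + 1 by rewrite !addr_gt0// mulr_gt0.
  have := key (t / (C * D + C + 1)); rewrite divr_gt0// => /(_ isT).
  by rewrite mulrC divfK// lt0r_neq0.
move=> err0.
(* From [N0] on, the exceptional sets have total mass at most [err]. *)
have [N0 hN0] : exists N0 : nat, rho ^+ N0 / (1 - rho) <= err.
  have /cvgr0Pnorm_le : rho ^+ n @[n --> \oo] --> (0 : R).
    by apply: cvg_expr; rewrite ger0_norm// ltW.
  have p : 0 < err * (1 - rho) by rewrite mulr_gt0// subr_gt0.
  move=> /(_ _ p)[N _ hN]; exists N.
  have rN : 0 <= rho ^+ N by rewrite exprn_ge0// ltW.
  have := hN N (leqnn N); rewrite /= (ger0_norm rN) => h.
  by rewrite ler_pdivrMr// subr_gt0.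
have qN0 : 0 < q%:R ^+ N0 :> R by rewrite exprn_gt0.
(* Covering sets of diameter at most [q ^- N0] have a scale [n >= N0]. *)
have : (hausdorff_premeasure s (q%:R ^- N0) F < err%:E)%E.
  apply: le_lt_trans (_ : (0 < err%:E)%E); last by rewrite lte_fin.
  rewrite -HF; apply: ereal_sup_ubound; exists (q%:R ^- N0) => //=.
  by rewrite invr_gt0.
move=> /ereal_inf_lt[_ [U [FU dU] <-] sumU].
(* The summand [err / 2 ^ i.+1] accounts for sets of diameter 0, whose power [diam_pow] may vanish
   although they are nonempty. *)
have hV i : exists V, [/\ measurable V,
    (mu V <= (C * D)%:E * diam_pow s (U i) + (C * (err / (2 ^ i.+1)%:R))%:E)%E &
    U i `<=` V `|` \bigcup_n E (N0 + n)%N].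
  have ei : 0 < err / (2 ^ i.+1)%:R by rewrite divr_gt0// ltr0n expn_gt0.
  have pw0 : (0 <= diam_pow s (U i))%E.
    by rewrite /diam_pow; case: ifP => // _; exact: poweR_ge0.
  have bnd0 : (0 <= (C * D)%:E * diam_pow s (U i) + (C * (err / (2 ^ i.+1)%:R))%:E)%E.
    by rewrite adde_ge0// ?mule_ge0// lee_fin mulr_ge0// ltW.
  have [Ui0|/set0P[x Ux]] := eqVneq (U i) set0.
    by exists set0; split; [exact: measurable0|rewrite measure0|rewrite Ui0].
  have dUi y z : U i y -> U i z -> ((circle_dist y z)%:E <= diam (U i))%E.
    by move=> Uy Uz; apply: ereal_sup_ubound; exists y => //; exists z.
  have dge0 : (0 <= diam (U i))%E by have := dUi x x Ux Ux; rewrite circle_distxx.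
  have [d dE] : exists d : R, diam (U i) = d%:E.
    move: dge0 (dU i); case: (diam (U i)) => [d| |]//=.
    by move=> _ _; exists d.
  have d0 : 0 <= d by rewrite -lee_fin -dE.
  have dN : d * q%:R ^+ N0 <= 1.
    by have := dU i; rewrite dE lee_fin -[_ ^- _]mul1r ler_pdivlMr.
  have [n Nn [dn hn]] := scale_exists Q2 s0 e0 d0 dN ei.
  have powE : diam_pow s (U i) = (d `^ s)%:E.
    by rewrite /diam_pow ifF ?dE ?poweR_EFin//; apply/eqP => U0; rewrite U0 in Ux.
  have [UE|UE] := pselect (U i `<=` E n).
    exists set0; split; [exact: measurable0|by rewrite measure0|].
    by move=> y /UE Ey; right; exists (n - N0)%N => //; rewrite subnKC.
  have [y [Uy Ey]] : exists y, U i y /\ ~ E n y.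
    by apply: contrapT => h; apply: UE => z Uz; apply: contrapT => Ez; apply: h;
      exists z.
  have qn : 0 < q%:R ^+ n :> R by rewrite exprn_gt0.
  (* The arc of radius [q ^- n] around the good point [y] contains [U i]. *)
  have mV := measure_ball_le mu_riesz a1 q2 mean_factor (repr y) n e0.
  eexists; split; [|apply: le_trans mV _|].
  - by apply: measurable_circle_fun_ge; [exact: continuous_tent|exact: tentD1].
  - rewrite powE -EFinM -EFinD lee_fin -/C -/f -mulrA.
    rewrite -[C * D * _]mulrA -mulrDr ler_pM2l//.
    (* At a good point the exponent is below [n * (B + 3 * e) - n * ln q], hence below
       [- n * (s * ln q + e)]. *)
    apply: le_trans hn; rewrite natrX mulrC -[q%:R]lnK ?posrE//.
    rewrite -expRM_natl -expRN -expRD ler_expR expRK.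
    have {Ey} : birkhoff_sum q n f (repr y) < n%:R * (B + 3 * e).
      by rewrite ltNge; apply/negP.
    have := ler_wpM2l (ler0n R n) e4; lra.
  - move=> z Uz; left; rewrite /= /circle_fun le_max; apply/orP; right.
    have : circle_dist y z <= d by rewrite -lee_fin -dE; exact: dUi.
    rewrite circle_dist_sym /circle_dist => h.
    have := ler_wpM2r (ltW qn) h; rewrite natrX; lra.
have {}hV := choice hV.
have [V hV'] := hV.
have := @measure_sigma_subadditive _ _ _ mu F (fun i => V i `|` E (N0 + i)%N) _ mF _.
move=> h; apply: le_trans (h _ _) _.
- by move=> i; apply: measurableU => //; case: (hV' i).
- move=> x /FU[i _ Uix]; have [_ _ /(_ _ Uix)[Vx|[n _ Ex]]] := hV' i.
    by exists i => //; left.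
  by exists n => //; right.
(* The exceptional sets are enumerated along with the cover, one [E (N0 + i)] for each [V i], so a
   single series bounds [mu F]. *)
pose w i : \bar R := (((C * D)%:E * diam_pow s (U i) + (C * (err / (2 ^
  i.+1)%:R))%:E) + (rho ^+ (N0 + i))%:E)%E.
have pw0 i : (0 <= diam_pow s (U i))%E.
  by rewrite /diam_pow; case: ifP => // _; exact: poweR_ge0.
have t1 i : (0 <= (C * D)%:E * diam_pow s (U i))%E by rewrite mule_ge0//
  lee_fin mulr_ge0// ltW.
have t2 i : (0 <= (C * (err / (2 ^ i.+1)%:R))%:E)%E.
  by rewrite lee_fin mulr_ge0 ?ltW// divr_gt0// ltr0n expn_gt0.
have t3 i : (0 <= (rho ^+ (N0 + i))%:E)%E by rewrite lee_fin exprn_ge0// ltW.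
apply: (@le_trans _ _ (\sum_(0 <= i <oo) w i)%E).
  apply: lee_nneseries => // i _.
  have [mVi mVi' _] := hV' i.
  apply: le_trans (measureU2 mu mVi (mE _)) _.
  by apply: leeD => //; exact: hrho.
rewrite /w nneseriesD//; last by move=> i _ _; rewrite adde_ge0.
rewrite nneseriesD//.
have -> : ((C * D + C + 1) * err)%:E = ((C * D)%:E * err%:E + (C * err)%:E + err%:E)%E.
  by rewrite -EFinM -!EFinD; congr EFin; ring.
apply: leeD; first apply: leeD.
- rewrite nneseriesZl//; apply: lee_wpmul2l; last exact: ltW.
  by rewrite lee_fin mulr_ge0// ltW.
- under eq_eseriesr do rewrite EFinM.
  rewrite nneseriesZl//; last by move=> i _; rewrite lee_fin divr_ge0// ltW.
  rewrite [X in (_ <= X)%E]EFinM; apply: lee_wpmul2l; first by rewrite lee_fin ltW.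
  by apply: epsilon_trick0; exact: ltW.
- apply: lime_le; first exact: is_cvg_nneseries.
  apply: nearW => n; rewrite sumEFin lee_fin; apply: le_trans hN0.
  have := @geometric_le_lim R n (rho ^+ N0) rho (exprn_ge0 _ (ltW rho0)) rho0.
  rewrite (ger0_norm (ltW rho0)) => /(_ rho1); apply: le_trans.
  by rewrite /series/=; apply: ler_sum => i _; rewrite exprD.
Qed.

(** A set of dimension below the bound has vanishing [s]-dimensional Hausdorff measure for some [s]
    still below it, hence is [mu]-null. *)
Lemma lower_hausdorff_dim_ge : ((1 - B / ln q%:R)%:E <= lower_hausdorff_dim mu)%E.
Proof.
apply: le_ereal_inf_tmp => _ [alpha [F [mF muF dimF]] <-].
rewrite leNgt; apply/negP => lt_alpha; apply: muF.
have /ereal_inf_lt[_ [s [s0 Hs] <-]] := le_lt_trans dimF lt_alpha.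
by rewrite lte_fin => sB; exact: (measure_eq0_of_hausdorff s0 sB).
Qed.

End LowerDimension.

(** * The dimension bound for even [q] *)

Unset Implicit Arguments.

Theorem proposition1p5 (R : realType) (q : nat) (a : R)
    (mu : {finite_measure set (circle R) -> \bar R})
    (q_even : ~~ odd q) (q_ge4 : (4 <= q)%N) (a_itv : -1 <= a <= 1)
    (mu_riesz : is_riesz_product a q mu) :
  ((1 - (1 - ln 2) / ln q%:R
    - 1 / (q%:R * ln q%:R) *
      (2 * ln 2 +
       2 / (q%:R * cos (pi / q%:R)) *
       \int[lebesgue_measure]_(z in `[pi / 2, q%:R * pi / 4])
         (ln (cos z ^+ 2) * sin (2 * z / q%:R)))
    + ln (cos (pi / q%:R)) / ln q%:R)%:E
   <= lower_hausdorff_dim mu)%E.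
Proof.
have q0 : (0 < q)%N by exact: leq_trans q_ge4.
have q2 : (2 <= q)%N by exact: leq_trans q_ge4.
have qn0 : q%:R != 0 :> R by rewrite pnatr_eq0 -lt0n.
have lq : 0 < ln q%:R :> R by rewrite ln_gt0// ltr1n.
set J := 2 / _ * _.
(* The cosine has zero sum over rotations, so the mean is exactly 1. *)
have mean_factor y : fold_mean q (riesz_factor a) y <= 1.
  rewrite (fold_mean_cos2pi (fun s => 1 + a * cos s))// /rot_sum big_split/=.
  rewrite -mulr_sumr sumr_const card_ord.
  have := rot_sum_cos q_even q_ge4 (2 * pi * y / q%:R); rewrite /rot_sum => ->.
  by rewrite mulr0 addr0 divff.
have mean_entropy y : fold_mean q (fun x => riesz_factor a x * ln (riesz_factor a x)) y
    <= 1 - ln 2 + 1 / q%:R * (2 * ln 2 + J).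
  rewrite (fold_mean_cos2pi (fun s => (1 + a * cos s) * ln (1 + a * cos s)))//.
  exact: mean_entropy_le.
apply: le_trans (lower_hausdorff_dim_ge mu_riesz a_itv q2 mean_factor mean_entropy).
rewrite lee_fin.
have -> : 1 - (1 - ln 2 + 1 / q%:R * (2 * ln 2 + J)) / ln q%:R =
    1 - (1 - ln 2) / ln q%:R - 1 / (q%:R * ln q%:R) * (2 * ln 2 + J).
  by field; rewrite lt0r_neq0.
(* The remaining term [ln (cos (pi / q)) / ln q] is nonpositive. *)
rewrite gerDl; apply: mulr_le0_ge0; last by rewrite invr_ge0 ltW.
exact: ln_le0 (cos_le1 _).
Qed.
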